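(* Let $\alpha\in[1,2]$, $c=\frac1{7-\alpha}$, $x^{-1}=x^0\in\mathbb R^n$, $\gamma_0>0$, $L_0>0$, $\rho_0=1$, and let the iterates be generated for $k=0,1,2,\dots$ by $$\gamma_{k+1}=\min\Bigl\{\gamma_k\sqrt{\tfrac1\alpha+\rho_k},\ \bigl(\tfrac23+\tfrac{2\alpha}5\bigr)\gamma_k,\ \tfrac{c}{L_k}\Bigr\},\qquad \rho_{k+1}=\frac{\gamma_{k+1}}{\gamma_k},$$ $$u^{k+1}=F(x^k)+\alpha\rho_{k+1}\bigl(F(x^k)-F(x^{k-1})\bigr),\qquad x^{k+1}=\operatorname{prox}_{\gamma_{k+1}g}\bigl(x^k-\gamma_{k+1}u^{k+1}\bigr).$$ Then for any solution $x^\star\in\operatorname{zer}T$ the following hold: 1. (Lyapunov descent) $0\le\mathcal U^\alpha_{k+1}(x^\star)\le\mathcal U^\alpha_k(x^\star)$ holds for any $k\in\mathbb N$; in particular, $(x^k)$ is bounded. 2. (Stepsize magnitude) $\gamma_k\ge\min\bigl\{\gamma_0,\frac{c}{\sqrt\alpha\,L_{F,\mathcal V}}\bigr\}$ for any $k\in\mathbb N$, where $L_{F,\mathcal V}$ is a Lipschitz modulus for $F$ on a compact and convex set $\mathcal V$ containing all the iterates $x^k$. 3. (Stampacchia gap) $\displaystyle\min_{k\le K}V_k(x^\star)\le\frac{\mathcal U^\alpha_1(x^\star)}{\sum_{k=1}^{K+1}\gamma_k}$ for all $K\in\mathbb N$, and in particular the left-hand side vanishes with rate $O(1/K)$. 4.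 (Average stepsize magnitude) $\frac1K\sum_{k=1}^K\gamma_k\ge\min\bigl\{\gamma_0,\frac{c}{L_{F,\mathcal V}}\bigr\}$ for any $K\in\mathbb N$, with $L_{F,\mathcal V}$ as in item 2. 5. (Sequence convergence) $(x^k)$ converges to a solution $x^\infty$ with $\mathcal U^\alpha_k(x^\infty)\to0$, and $\lim_{k\to\infty}V_k(x^\star)=0$ for any $x^\star\in\operatorname{zer}T$.
   Context: Standing assumptions: $F:\mathbb R^n\to\mathbb R^n$ is monotone and locally Lipschitz continuous; $g:\mathbb R^n\to\mathbb R\cup\{+\infty\}$ is proper, convex and lower semicontinuous; $\operatorname{zer}T=\{x:0\in Tx\}\ne\emptyset$, where $Tx:=F(x)+\partial g(x)$; a solution is an element of $\operatorname{zer}T$. $\operatorname{prox}_{\gamma g}(y)=\arg\min_z\{g(z)+\frac1{2\gamma}\|z-y\|^2\}$. For $k\ge1$, $L_k:=\|F(x^k)-F(x^{k-1})\|/\|x^k-x^{k-1}\|$ (with $\frac00=0$, and $\frac c0=+\infty$ in the stepsize update); $L_0$ is the given initial parameter. For $x\in\operatorname{dom}g$, $V_k(x):=g(x^k)-g(x)-\langle F(x^k),x-x^k\rangle$, and, for $k\in\mathbb N$ (with $x^{-2}:=x^0$ when $k=0$), $$\mathcal U^\alpha_k(x):=\tfrac12\|x^k-x\|^2+\tfrac12\|x^k-x^{k-1}\|^2+\tfrac{\lambda(\gamma_k\rho_k)^2}{2}\|F(x^{k-1})-F(x^{k-2})\|^2+(1+\alpha\rho_k)\gamma_kV_{k-1}(x),$$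 with values in $\mathbb R\cup\{+\infty\}$. The constant $\lambda$ is $$\lambda=2(\alpha\beta)^2\Bigl(1+\frac{2-\alpha}{2\alpha\varepsilon}+\frac1\mu\Bigr),\quad \beta=\min\Bigl\{\tfrac23+\tfrac{2\alpha}5,\ \tfrac12\Bigl(1+\sqrt{1+\tfrac4\alpha}\Bigr)\Bigr\},\quad \mu=\frac{\alpha\beta^2}{1+\alpha\beta},\quad \varepsilon=\beta\bar c,$$ $$\bar c=\frac{1+2\beta^2(\alpha-1)}{\alpha(2-\alpha)\beta^3+\sqrt{\bigl(\alpha(2-\alpha)\beta^3\bigr)^2+2\bigl(1+2\beta^2(\alpha-1)\bigr)\bigl(1+\alpha\beta+\alpha\beta^2\bigr)^2}}.$$
   Formalization: Item 1's descent U_{k+1} ≤ U_k is stated for k≥1 only (it can fail at k=0); item 2 assumes γ_0L_0≤c or L_0≤L_{F,V}, and item 4 assumes γ_0L_0≤c or √α·L_0≤L_{F,V} (such a modulus always exists), since both can fail when L_0 is too large. *)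

(* Defs.v *)
From HB Require Import structures.
From mathcomp Require Import all_boot all_order all_algebra.
From mathcomp Require Import all_classical all_reals all_analysis.

Set Implicit Arguments.
Unset Strict Implicit.
Unset Printing Implicit Defensive.

Import Order.TTheory GRing.Theory Num.Theory.
Import numFieldNormedType.Exports.

Local Open Scope classical_set_scope.
Local Open Scope ring_scope.

Section Euclidean.
Context {R : realType} {n : nat}.
Implicit Types (u v x y z : 'rV[R]_n) (F : 'rV[R]_n -> 'rV[R]_n)
  (g : 'rV[R]_n -> \bar R).

Definition inner u v : R := \sum_(i < n) u 0 i * v 0 i.

(* The library norm of 'rV[R]_n is the sup norm, hence this definition. The
   topology of 'rV[R]_n is the one of R^n. *)
Definition enorm u : R := Num.sqrt (inner u u).

Definition monotone_op F := forall x y, 0 <= inner (F x - F y) (x - y).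

Definition lipschitz_modulus F (A : set 'rV[R]_n) (L : R) :=
  0 <= L /\
  forall x y, A x -> A y -> enorm (F x - F y) <= L * enorm (x - y).

Definition locally_lipschitz F :=
  forall x, exists2 A, nbhs x A & exists L, lipschitz_modulus F A L.

Definition proper_fun g := (forall x, g x != -oo%E) /\ exists x, (g x < +oo)%E.

Definition convex_fun g := forall x y (t : R), 0 < t -> t < 1 ->
  (g (t *: x + (1 - t) *: y)%R <= t%:E * g x + (1 - t)%:E * g y)%E.

(* For proper g this is empty outside the domain of g. *)
Definition subdifferential g x : set 'rV[R]_n :=
  [set v | forall y, (g x + (inner v (y - x))%:E <= g y)%E].

Definition sum_op F g x : set 'rV[R]_n :=
  [set F x + v | v in subdifferential g x].

Definition zer (T : 'rV[R]_n -> set 'rV[R]_n) : set 'rV[R]_n := [set x | T x 0].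

Definition prox_objective (gamma : R) g y z : \bar R :=
  (g z + ((2 * gamma)^-1 * enorm (z - y) ^+ 2)%:E)%E.

(* "get" selects a point of the set of minimizers, which is a singleton when
   gamma > 0 and g is proper, convex and lower semicontinuous. *)
Definition prox (gamma : R) g y : 'rV[R]_n :=
  get [set z | forall w, (prox_objective gamma g y z <=
                          prox_objective gamma g y w)%E].

End Euclidean.

Section Constants.
Context {R : realType}.
Variable alpha : R.

Definition cst_beta : R :=
  Num.min (2 / 3 + 2 * alpha / 5) (2^-1 * (1 + Num.sqrt (1 + 4 / alpha))).

Definition cst_mu : R := alpha * cst_beta ^+ 2 / (1 + alpha * cst_beta).

Definition cst_cbar : R :=
  (1 + 2 * cst_beta ^+ 2 * (alpha - 1)) /
  (alpha * (2 - alpha) * cst_beta ^+ 3 +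
   Num.sqrt ((alpha * (2 - alpha) * cst_beta ^+ 3) ^+ 2 +
             2 * (1 + 2 * cst_beta ^+ 2 * (alpha - 1)) *
             (1 + alpha * cst_beta + alpha * cst_beta ^+ 2) ^+ 2)).

Definition cst_eps : R := cst_beta * cst_cbar.

Definition cst_lambda : R :=
  2 * (alpha * cst_beta) ^+ 2 *
  (1 + (2 - alpha) / (2 * alpha * cst_eps) + cst_mu^-1).

End Constants.

(* Sequences are indexed by nat, and k.-1, k.-2 are truncated: x 0.-1, x 0.-2
   and x 1.-2 are all x 0, which encodes x^{-2} = x^{-1} = x^0. *)
Section Iterates.
Context {R : realType} {n : nat}.
Variables (F : 'rV[R]_n -> 'rV[R]_n) (g : 'rV[R]_n -> \bar R).
Variable x : nat -> 'rV[R]_n.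

(* 0 / 0 = 0 in R. *)
Definition lip_estimate (L0 : R) (k : nat) : R :=
  if k is 0%N then L0
  else enorm (F (x k) - F (x k.-1)) / enorm (x k - x k.-1).

(* Division in \bar R, so that c / 0 = +oo for c > 0. *)
Definition next_stepsize (alpha c L0 : R) (gamma rho : nat -> R) (k : nat) :
    \bar R :=
  Order.min (gamma k * Num.sqrt (alpha^-1 + rho k))%:E
    (Order.min ((2 / 3 + 2 * alpha / 5) * gamma k)%:E
       (c%:E / (lip_estimate L0 k)%:E)%E).

Definition extrapolation (alpha : R) (rho : nat -> R) (k : nat) : 'rV[R]_n :=
  F (x k) + (alpha * rho k.+1) *: (F (x k) - F (x k.-1)).

Definition gap (k : nat) (z : 'rV[R]_n) : \bar R :=
  (g (x k) - g z - (inner (F (x k)) (z - x k))%:E)%E.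

Definition lyapunov (alpha : R) (gamma rho : nat -> R) (k : nat)
    (z : 'rV[R]_n) : \bar R :=
  ((2^-1 * enorm (x k - z) ^+ 2 + 2^-1 * enorm (x k - x k.-1) ^+ 2
    + cst_lambda alpha * (gamma k * rho k) ^+ 2 / 2
      * enorm (F (x k.-1) - F (x k.-2)) ^+ 2)%:E
   + ((1 + alpha * rho k) * gamma k)%:E * gap k.-1 z)%E.

Definition hull_modulus (V : set 'rV[R]_n) (L : R) :=
  [/\ compact V, convex_set (V : set (convex_lmodType 'rV[R]_n)),
      forall k, V (x k) & lipschitz_modulus F V L].

End Iterates.

(* Main.v *)
Require Import Defs.
From HB Require Import structures.
From mathcomp Require Import all_boot all_order all_algebra.
From mathcomp Require Import all_classical all_reals all_analysis.
From mathcomp Require Import ring lra.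

Import Order.TTheory GRing.Theory Num.Theory.
Import numFieldNormedType.Exports.

Local Open Scope classical_set_scope.
Local Open Scope ring_scope.

(* Write [Delta_k = x_k - x_(k-1)], [D_k = F x_k - F x_(k-1)] and
   [E_k = gamma_k rho_k D_(k-1)].  The subgradient inequalities at [x_(k+1)] and
   [x_k] bound the increase of the Lyapunov function by [<w, Delta_(k+1)>],
   where [w = rho Delta_k - gamma (1 + alpha rho) D_k + alpha rho E_k], and also
   give [|Delta_(k+1)|^2 <= <w, Delta_(k+1)>], hence [<w, Delta_(k+1)> <= |w|^2].
   Young's inequality with weights [eps] and [mu], [gamma |D_k| <= c |Delta_k|]
   and [rho <= beta] reduce the descent to a scalar inequality, which at
   [rho = beta] says [c <= cbar].  Since [c < cbar] strictly, the descent leaves a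
   multiple of [|Delta_k|^2], so [Delta_k -> 0]; all terms of the Lyapunov
   function but [|x_k - x|^2 / 2] then vanish, cluster points are solutions by
   closedness of the subdifferential, and monotonicity of the Lyapunov function
   at a cluster point gives convergence of the whole sequence. *)

(** The stepsize bounds rest on a separate mechanism. A stepsize decreases in only two ways: through
    the term [c / L_k], where the Lipschitz modulus controls it, or through the square root after a
    ratio below [1 - 1 / alpha]. Such a ratio can only come from the term [c / L_k] one step
    earlier, and the square root then loses at most a factor [sqrt alpha]. For the average this loss
    is repaid: a ratio that small means that the stepsize before it was two or three times larger.

    The starting point shapes many statements. As [x_0] is not the output of a prox step, it carries
    no subgradient and [g x_0] may be infinite; real-valued estimates therefore start where [g] is
    known to be finite, and an infinite [g x_0] makes the bounds by [U_1] trivial. Likewise [L_0] is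
    a free parameter that no Lipschitz modulus of [F] controls, so the first step needs its own case
    in every stepsize bound. *)

Set Implicit Arguments.
Unset Strict Implicit.
Unset Printing Implicit Defensive.

(** * Numerical constants *)

(* Tells which term attains the minimum defining [cst_beta]. *)
Definition beta_spec (R : realFieldType) (a b : R) :=
  b = 2 / 3 + 2 * a / 5 /\ a * b ^+ 2 <= 1 + a * b \/
  b <= 2 / 3 + 2 * a / 5 /\ a * b ^+ 2 = 1 + a * b.

(** The equation reads [a * (b * (b - 1)) = 1], so [b] decreases in [a] while the linear bound
    increases; they cross near [a = 1.82]. The box is a rational enclosure of the arc beyond the
    crossing. *)
Lemma beta_box (R : realFieldType) (a b : R) :
  1 <= a -> a <= 2 -> 0 < b -> b <= 2 / 3 + 2 * a / 5 -> a * b ^+ 2 = 1 + a * b ->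
  [/\ 18 / 10 <= a, 136 / 100 <= b & b <= 14 / 10].
Proof.
move=> a1 a2 b0 ble q.
have a18 : 18 / 10 <= a.
  rewrite leNgt; apply/negP => h.
  (* [(s - b) * (b + s - 1) = s * (s - 1) - b * (b - 1)], here with [s] just above the linear bound
     at [a = 18 / 10]. The bounds on [b] use the same identity. *)
  suff : 0 < a * ((1387 / 1000 - b) * (b + 387 / 1000)) by lra.
  by rewrite !mulr_gt0; lra.
split => //; rewrite leNgt; apply/negP => h.
  suff : 0 < a * ((136 / 100 - b) * (b + 36 / 100)) by lra.
  by rewrite !mulr_gt0; lra.
suff : 0 < a * ((b - 14 / 10) * (b + 4 / 10)) by lra.
by rewrite !mulr_gt0; lra.
Qed.

(* For [b = cst_beta a] this is [(7 - a)^-1 < cst_cbar a].  Both cases are settled by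
   the signs of Bernstein coefficients: in [a] on the interval from 1 to 183/100, and in
   [(a, b)] on the box of [beta_box]. *)
Lemma stepsize_const_poly (R : realFieldType) (a b : R) : 1 <= a -> a <= 2 -> 0 < b ->
  beta_spec a b ->
  2 * (1 + a * b + a * b ^+ 2) ^+ 2 + 2 * (a * (2 - a) * b ^+ 3) * (7 - a) <
  (1 + 2 * b ^+ 2 * (a - 1)) * (7 - a) ^+ 2.
Proof.
move=> a1 a2 b0 [[bE q]|[ble q]].
- have a183 : a <= 183 / 100.
    rewrite leNgt; apply/negP => h; rewrite bE in q.
    by nra.
  have B i : 0 <= (a - 1) ^+ i * (183 / 100 - a) ^+ (6 - i).
    by rewrite mulr_ge0 ?exprn_ge0; lra.
  have := (B 0, B 1, B 2, B 3, B 4, B 5, B 6).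
  by rewrite /= bE => -[[[[[[]]]]]]; lra.
have [a18 bl bu] := beta_box a1 a2 b0 ble q.
(* Reducing by [q] lowers the degree in [b] to two, so that Bernstein products of bidegree (3, 2)
   suffice. *)
have e2 : a * b ^+ 3 = b + (1 + a * b).
  by have := congr1 ( *%R b) q; lra.
have -> : a * (2 - a) * b ^+ 3 = (2 - a) * (b + (1 + a * b)) by rewrite -e2; ring.
have -> : 2 * b ^+ 2 * (a - 1) = 2 * (1 + a * b) - 2 * b ^+ 2 by rewrite -q; ring.
rewrite q.
have B i j : 0 <= (a - 18/10) ^+ i * (2 - a) ^+ (3 - i) * ((b - 136/100) ^+ j * (14/10 - b) ^+ (2 - j)).
  by rewrite !mulr_ge0 ?exprn_ge0; lra.
have := (B 0 0, B 1 0, B 2 0, B 3 0, B 0 1, B 1 1, B 2 1, B 3 1, B 0 2, B 1 2, B 2 2, B 3 2).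
by move=> [[[[[[[[[[[]]]]]]]]]]] /=; lra.
Qed.

(* With [c = (7 - a)^-1], this makes [rho = beta] the worst case of the scalar descent
   inequality of [lyapunov_coef]. *)
Lemma stepsize_mono_poly (R : realFieldType) (a b : R) : 1 <= a -> a <= 2 -> 0 < b ->
  beta_spec a b ->
  let q := 1 + a * b + a * b ^+ 2 in
  0 <= a * q + b * (1 + a * b) * (- (a - 1) * (7 - a) ^+ 2 + a * (2 - a) * b * (7 - a))
    + b * a ^+ 2 * q + b * a * q * (1 + a * b).
Proof.
move=> a1 a2 b0 [[bE q]|[ble q]] /=.
- have a183 : a <= 183 / 100.
    rewrite leNgt; apply/negP => h; rewrite bE in q.
    by nra.
  have B i : 0 <= (a - 1) ^+ i * (183 / 100 - a) ^+ (7 - i).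
    by rewrite mulr_ge0 ?exprn_ge0; lra.
  have := (B 0, B 1, B 2, B 3, B 4, B 5, B 6, B 7).
  by rewrite /= bE => -[[[[[[[]]]]]]]; lra.
have [a18 bl bu] := beta_box a1 a2 b0 ble q.
rewrite q.
set X := (X in 0 <= X).
have -> : X = (1 + a * b) * (2 * a + b * (- (a - 1) * (7 - a) ^+ 2 + a * (2 - a) * b * (7 - a))
    + 2 * b * a ^+ 2 + 2 * b * a * (1 + a * b)) by rewrite /X; ring.
rewrite mulr_ge0//; first by rewrite addr_ge0 ?mulr_ge0; lra.
have B i j : 0 <= (a - 18/10) ^+ i * (2 - a) ^+ (3 - i) * ((b - 136/100) ^+ j * (14/10 - b) ^+ (2 - j)).
  by rewrite !mulr_ge0 ?exprn_ge0; lra.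
have := (B 0 0, B 1 0, B 2 0, B 3 0, B 0 1, B 1 1, B 2 1, B 3 1, B 0 2, B 1 2, B 2 2, B 3 2).
by move=> [[[[[[[[[[[]]]]]]]]]]] /=; lra.
Qed.

(** The second term of [cst_beta] is the fixed point of [s |-> sqrt (1 / a + s)]. The last clause
    thus says that the stepsize rule cannot push a ratio above [cst_beta]; it is the induction step
    of [rho_le_beta]. *)
Lemma cst_beta_spec (R : realType) (a : R) : 1 <= a -> a <= 2 ->
  [/\ 1 <= cst_beta a, cst_beta a <= 2 / 3 + 2 * a / 5, beta_spec a (cst_beta a) &
    forall r, 0 <= r -> r <= 2 / 3 + 2 * a / 5 ->
      (exists2 s, s <= cst_beta a & a * r ^+ 2 <= 1 + a * s) -> r <= cst_beta a].
Proof.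
move=> a1 a2; rewrite /beta_spec /cst_beta.
set l := 2 / 3 + _; set r := 2^-1 * _.
have a0 : 0 < a by lra.
have rE : a * r ^+ 2 = 1 + a * r.
  have : Num.sqrt (1 + 4 / a) ^+ 2 = 1 + 4 / a by rewrite sqr_sqrtr// addr_ge0 ?divr_ge0; lra.
  rewrite /r; set s := Num.sqrt _ => e.
  have : a * s ^+ 2 = a + 4 by rewrite e mulrDr mulr1 mulrCA divff ?mulr1//; lra.
  by lra.
have r1 : 1 <= r.
  have : 1 <= Num.sqrt (1 + 4 / a).
    by rewrite -[X in X <= _]sqrtr1 ler_wsqrtr// lerDl divr_ge0//; lra.
  by rewrite /r; lra.
have mon u : 1 <= u -> u <= r -> a * u ^+ 2 <= 1 + a * u.
  move=> u1 ur; suff : 0 <= a * ((r - u) * (r + u - 1)) by lra.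
  by rewrite !mulr_ge0; lra.
have key u s : 0 <= u -> s <= r -> a * u ^+ 2 <= 1 + a * s -> u <= r.
  move=> u0 sr h; rewrite leNgt; apply/negP => ru.
  have : 0 < a * ((u - r) * (u + r)) by rewrite !mulr_gt0; lra.
  have : a * s <= a * r by rewrite ler_wpM2l; lra.
  by lra.
have l1 : 1 <= l by rewrite /l; lra.
case: (leP l r) => lr.
  split => //.
    by left; split => //; apply: mon.
split => //.
- by rewrite ltW.
- by right; split => //; rewrite ltW.
- by move=> u u0 _ [s sr h]; apply: key h.
Qed.

(** The weights are [cst_mu] and [cst_eps]. At [r = b], [cst_mu] minimises [(1 + m) * (1 + a * b)^2
    + (1 + 1 / m) * (a * b^2)^2], with minimum [q^2], and [cst_eps] minimises the terms in [e] when
    [c = cst_cbar]. The left side vanishes for [r = b], [c = cst_cbar], so the strict inequality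
    [c < cst_cbar] leaves room for [d]. *)
Lemma lyapunov_coef (R : realType) (a c : R) : 1 <= a -> a <= 2 -> c = (7 - a)^-1 ->
  exists m e d, [/\ 0 < m, 0 < e, 0 < d,
    cst_lambda a / 2 = (a * cst_beta a) ^+ 2 * (1 + (2 - a) / (2 * a * e) + m^-1) &
    forall r, 0 <= r -> r <= cst_beta a ->
     (1 - a) * r ^+ 2 - 2^-1 + a * (2 - a) * r ^+ 2 * e / 2 +
     c ^+ 2 * ((1 + m) * (1 + a * r) ^+ 2 + cst_lambda a / 2 * r ^+ 2) <= - d].
Proof.
move=> a1 a2 cE.
have [b1 _ bs _] := cst_beta_spec a1 a2.
set b := cst_beta a in b1 bs *.
have b0 : 0 < b by lra.
have a0 : 0 < a by lra.
have ab0 : 0 < a * b by rewrite mulr_gt0.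
have Gp := stepsize_const_poly a1 a2 b0 bs.
have Mp := stepsize_mono_poly a1 a2 b0 bs.
rewrite /= in Mp.
have c0 : 0 < c by rewrite cE invr_gt0; lra.
have c7 : c * (7 - a) = 1 by rewrite cE mulVf; lra.
set q := 1 + a * b + a * b ^+ 2 in Gp Mp.
have q0 : 0 < q by rewrite /q !addr_gt0 ?mulr_gt0 ?exprn_gt0.
set P := 1 + 2 * b ^+ 2 * (a - 1).
have P0 : 0 < P by rewrite ltr_pwDl// !mulr_ge0 ?exprn_ge0; lra.
set B := a * (2 - a) * b ^+ 3 in Gp.
have B0 : 0 <= B by rewrite !mulr_ge0 ?exprn_ge0; lra.
have cP : 2 * (q * c) ^+ 2 + 2 * B * c < P.
  have : c ^+ 2 * (2 * q ^+ 2 + 2 * B * (7 - a)) < c ^+ 2 * (P * (7 - a) ^+ 2).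
    by rewrite ltr_pM2l// exprn_gt0.
  have -> : c ^+ 2 * (P * (7 - a) ^+ 2) = P by rewrite mulrCA -exprMn c7 expr1n mulr1.
  have -> : c ^+ 2 * (2 * q ^+ 2 + 2 * B * (7 - a)) = 2 * (q * c) ^+ 2 + 2 * B * c * (c * (7 - a)) by ring.
  by rewrite c7 mulr1.
set w := cst_cbar a.
(* [cst_cbar] is the positive root of a quadratic equation. *)
have [w0 wP] : 0 < w /\ 2 * (q * w) ^+ 2 + 2 * B * w = P.
  rewrite /w /cst_cbar -/b -/P -/B -/q.
  set D := B ^+ 2 + _.
  have D0 : 0 < D by rewrite ltr_wpDl ?sqr_ge0// !mulr_gt0 ?exprn_gt0.
  set s := Num.sqrt D.
  have s0 : 0 < s by rewrite sqrtr_gt0.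
  have sE : s ^+ 2 = D by rewrite sqr_sqrtr// ltW.
  have Bs : B + s != 0 by rewrite gt_eqF// ltr_wpDl.
  split; first by rewrite divr_gt0// ltr_wpDl.
  apply: (mulIf (_ : (B + s) ^+ 2 != 0)); first by rewrite expf_neq0.
  have -> : (2 * (q * (P / (B + s))) ^+ 2 + 2 * B * (P / (B + s))) * (B + s) ^+ 2 =
     2 * (q * P) ^+ 2 + 2 * B * P * (B + s) by field.
  have -> : P * (B + s) ^+ 2 = P * B ^+ 2 + 2 * P * B * s + P * s ^+ 2 by ring.
  by rewrite sE /D; ring.
have eE : cst_eps a = b * w by [].
clearbody w.
have q0' := ltW q0; have c0' := ltW c0; have w0' := ltW w0.
have cw : c < w.
  rewrite ltNge; apply/negP => wc.
  have : (q * w) ^+ 2 <= (q * c) ^+ 2.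
    by rewrite lerXn2r ?nnegrE ?mulr_ge0 ?ler_wpM2l//.
  have : B * w <= B * c by rewrite ler_wpM2l.
  by lra.
set m := cst_mu a.
have m0 : 0 < m by rewrite /m /cst_mu -/b divr_gt0 ?mulr_gt0 ?addr_gt0 ?exprn_gt0.
have m1E : 1 + m = q / (1 + a * b).
  by rewrite /m /cst_mu -/b /q; field; rewrite gt_eqF// addr_gt0.
have mVE : 1 + m^-1 = q / (a * b ^+ 2).
  by rewrite /m /cst_mu -/b /q; field; rewrite ?gt_eqF//= ?addr_gt0.
set e := cst_eps a in eE.
have e0 : 0 < e by rewrite eE mulr_gt0.
have lE : cst_lambda a / 2 = (a * b) ^+ 2 * (1 + (2 - a) / (2 * a * e) + m^-1).
  by rewrite /cst_lambda -/b -/e -/m; field; rewrite !gt_eqF.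
pose f r := (1 - a) * r ^+ 2 - 2^-1 + a * (2 - a) * r ^+ 2 * e / 2 +
     c ^+ 2 * ((1 + m) * (1 + a * r) ^+ 2 + cst_lambda a / 2 * r ^+ 2).
clearbody e m.
have lE2 : cst_lambda a / 2 = a * q + a * (2 - a) * b / (2 * w).
  transitivity ((a * b) ^+ 2 * (1 + m^-1) + (a * b) ^+ 2 * ((2 - a) / (2 * a * e))).
    by rewrite lE; ring.
  by rewrite mVE eE; field; rewrite !gt_eqF.
have fb : f b < 0.
  have -> : f b = - (P / 2) + B * (w / 2 + c ^+ 2 / (2 * w)) + (q * c) ^+ 2.
    rewrite /f lE2 m1E eE /P /B /q; field.
    by rewrite !gt_eqF// addr_gt0.
  have : c ^+ 2 / (2 * w) <= w / 2.
    rewrite ler_pdivrMr ?mulr_gt0//.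
    have : c ^+ 2 <= w ^+ 2 by rewrite lerXn2r ?nnegrE// ltW.
    by lra.
  move=> /(ler_wpM2l B0) h.
  have : (q * c) ^+ 2 < (q * w) ^+ 2.
    by rewrite ltrXn2r ?nnegrE ?mulr_ge0 ?ltr_pM2l.
  by lra.
exists m, e, (- f b); split => //; first by rewrite oppr_gt0.
move=> r r0 rb; rewrite opprK -/(f r).
(* [f] is quadratic with leading coefficient [C], so its derivative is affine. It is nonnegative at
   0 and, by [Cge], at [b]; hence [f] increases on [[0, b]]. *)
pose C := (1 - a) + a * (2 - a) * e / 2 + c ^+ 2 * ((1 + m) * a ^+ 2 + cst_lambda a / 2).
have fE : f b - f r = (b - r) * (2 * a * c ^+ 2 * (1 + m) + C * (b + r)).
  by rewrite /f /C; ring.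
rewrite -subr_ge0 fE mulr_ge0//; first by rewrite subr_ge0.
have Cge : 0 <= a * c ^+ 2 * (1 + m) + C * b.
  (* The bound [w / 2 + c^2 / (2 * w) >= c] eliminates [w], which contains a square root; what
     remains is [stepsize_mono_poly]. *)
  have C1 : (1 - a) + a * (2 - a) * b * c + c ^+ 2 * ((1 + m) * a ^+ 2 + a * q) <= C.
    have -> : C = (1 - a) + a * (2 - a) * b * (w / 2 + c ^+ 2 / (2 * w)) + c ^+ 2 * ((1 + m) * a ^+ 2 + a * q).
      rewrite /C lE2 eE; field; rewrite gt_eqF//.
    rewrite lerD2r lerD2l ler_wpM2l//; first by rewrite !mulr_ge0; lra.
    have -> : w / 2 + c ^+ 2 / (2 * w) = c + (w - c) ^+ 2 / (2 * w) by field; rewrite gt_eqF.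
    by rewrite lerDl divr_ge0 ?sqr_ge0// mulr_ge0// ltW.
  apply: le_trans (_ : _ <= a * c ^+ 2 * (1 + m) + ((1 - a) + a * (2 - a) * b * c + c ^+ 2 * ((1 + m) * a ^+ 2 + a * q)) * b) _; last first.
    by rewrite lerD2l ler_wpM2r// ltW.
  rewrite m1E cE.
  set X := (X in 0 <= X).
  have -> : X = (a * q + b * (1 + a * b) * (- (a - 1) * (7 - a) ^+ 2 + a * (2 - a) * b * (7 - a))
    + b * a ^+ 2 * q + b * a * q * (1 + a * b)) / ((1 + a * b) * (7 - a) ^+ 2).
    rewrite /X; field; rewrite !gt_eqF//; lra.
  by rewrite divr_ge0// mulr_ge0 ?exprn_ge0; lra.
have p0 : 0 <= a * c ^+ 2 * (1 + m) by rewrite !mulr_ge0 ?exprn_ge0; lra.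
have [C0|C0] := leP 0 C.
  have : 0 <= C * (b + r) by rewrite mulr_ge0//; lra.
  by lra.
have : 0 <= - C * (b - r) by rewrite mulr_ge0//; lra.
by lra.
Qed.

(** * Euclidean inner product *)

Section inner.
Context {R : realType} {n : nat}.
Implicit Types (u v w : 'rV[R]_n).

Lemma innerC u v : inner u v = inner v u.
Proof. by apply: eq_bigr => i _; rewrite mulrC. Qed.

Lemma innerDl u v w : inner (u + v) w = inner u w + inner v w.
Proof. by rewrite -big_split; apply: eq_bigr => i _; rewrite !mxE mulrDl. Qed.

Lemma innerZl (a : R) u v : inner (a *: u) v = a * inner u v.
Proof. by rewrite mulr_sumr; apply: eq_bigr => i _; rewrite !mxE mulrA. Qed.

Lemma innerNl u v : inner (- u) v = - inner u v.
Proof. by rewrite -scaleN1r innerZl mulN1r. Qed.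

Lemma innerBl u v w : inner (u - v) w = inner u w - inner v w.
Proof. by rewrite innerDl innerNl. Qed.

Lemma innerDr u v w : inner u (v + w) = inner u v + inner u w.
Proof. by rewrite innerC innerDl !(innerC u). Qed.

Lemma innerZr (a : R) u v : inner u (a *: v) = a * inner u v.
Proof. by rewrite innerC innerZl innerC. Qed.

Lemma innerNr u v : inner u (- v) = - inner u v.
Proof. by rewrite innerC innerNl innerC. Qed.

Lemma innerBr u v w : inner u (v - w) = inner u v - inner u w.
Proof. by rewrite innerDr innerNr. Qed.

Definition innerE := (innerDl, innerDr, innerBl, innerBr, innerNl, innerNr, innerZl, innerZr).

Lemma inner0l v : inner 0 v = 0.
Proof. by rewrite -(scale0r v) innerZl mul0r. Qed.

Lemma inner_ge0 u : 0 <= inner u u.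
Proof. by apply: sumr_ge0 => i _; rewrite -expr2 sqr_ge0. Qed.

Lemma enorm_ge0 u : 0 <= enorm u.
Proof. exact: sqrtr_ge0. Qed.

Lemma enorm_sqr u : enorm u ^+ 2 = inner u u.
Proof. by rewrite sqr_sqrtr// inner_ge0. Qed.

Lemma inner_self_eq0 u : inner u u = 0 -> u = 0.
Proof.
move=> /eqP; rewrite psumr_eq0 => [/allP h|i _]; last by rewrite -expr2 sqr_ge0.
apply/rowP => i; rewrite mxE; apply/eqP.
by have := h i (mem_index_enum i); rewrite mulf_eq0 orbb.
Qed.

Lemma enorm0 : enorm (0 : 'rV[R]_n) = 0.
Proof. by rewrite /enorm inner0l sqrtr0. Qed.

Lemma enorm_eq0 u : enorm u = 0 -> u = 0.
Proof.
by move=> h; apply: inner_self_eq0; rewrite -enorm_sqr h expr0n.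
Qed.

Lemma enormN u : enorm (- u) = enorm u.
Proof. by rewrite /enorm !innerE opprK. Qed.

Lemma enormZ (a : R) u : enorm (a *: u) = `|a| * enorm u.
Proof. by rewrite /enorm !innerE mulrA -expr2 sqrtrM ?sqr_ge0// sqrtr_sqr. Qed.

Lemma inner_sqrDZ (a : R) u v :
  inner (u + a *: v) (u + a *: v) = inner u u + 2 * a * inner u v + a * a * inner v v.
Proof. by rewrite !innerE (innerC v u); ring. Qed.

Lemma inner_young (t : R) u v : 0 < t ->
  inner u v <= t / 2 * inner u u + (2 * t)^-1 * inner v v.
Proof.
move=> t0; have := inner_ge0 (t *: u - v); rewrite !innerE (innerC v u) => h.
rewrite -(ler_pM2l (_ : 0 < 2 * t)) ?mulr_gt0//.
set U := inner u u in h *; set W := inner v v in h *; set X := inner u v in h *.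
have -> : 2 * t * (t / 2 * U + (2 * t)^-1 * W) = t * t * U + W by field; rewrite gt_eqF.
by lra.
Qed.

Lemma inner_young_opp (t : R) u v : 0 < t ->
  - inner u v <= t / 2 * inner u u + (2 * t)^-1 * inner v v.
Proof. by move=> t0; have := inner_young (- u) v t0; rewrite !innerE opprK. Qed.

Lemma inner_le u v : inner u v <= enorm u * enorm v.
Proof.
have [u0|u0] := eqVneq (enorm u) 0.
  by rewrite (enorm_eq0 u0) inner0l mulr_ge0 ?enorm_ge0.
have [v0|v0] := eqVneq (enorm v) 0.
  by rewrite (enorm_eq0 v0) innerC inner0l mulr_ge0 ?enorm_ge0.
have eu : 0 < enorm u by rewrite lt_neqAle eq_sym u0 enorm_ge0.
have ev : 0 < enorm v by rewrite lt_neqAle eq_sym v0 enorm_ge0.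
apply: le_trans (inner_young u v (divr_gt0 ev eu)) _.
by rewrite -!enorm_sqr le_eqVlt; apply/orP; left; apply/eqP; field; rewrite u0 v0.
Qed.

Lemma enormD u v : enorm (u + v) <= enorm u + enorm v.
Proof.
rewrite -ler_sqr ?nnegrE ?addr_ge0 ?enorm_ge0// enorm_sqr !innerE (innerC v u) sqrrD.
by rewrite !enorm_sqr; have := inner_le u v; lra.
Qed.

Lemma norm_le_enorm u : `|u| <= enorm u.
Proof.
rewrite [leLHS]/Num.norm/= mx_normrE; apply: bigmax_le => [|[i j] _ /=].
  exact: enorm_ge0.
rewrite -sqrtr_sqr ler_wsqrtr// /inner (bigD1 j)//= (ord1 i) -expr2 lerDl.
by apply: sumr_ge0 => k _; rewrite -expr2 sqr_ge0.
Qed.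

Lemma cvg_inner (T : Type) (G : set_system T) {FG : Filter G} (f h : T -> 'rV[R]_n) u v :
  f @ G --> u -> h @ G --> v -> inner (f t) (h t) @[t --> G] --> inner u v.
Proof.
move=> fu hv; rewrite /inner; apply: cvg_big => [|i _].
  exact: add_continuous.
apply: cvgM.
  exact: (cvg_comp _ _ fu (@coord_continuous _ _ _ _ _ _)).
exact: (cvg_comp _ _ hv (@coord_continuous _ _ _ _ _ _)).
Qed.

Lemma cvg_enorm (T : Type) (G : set_system T) {FG : Filter G} (f : T -> 'rV[R]_n) u :
  f @ G --> u -> enorm (f t) @[t --> G] --> enorm u.
Proof.
move=> fu; apply: (cvg_comp _ _ (cvg_inner fu fu)).
exact: sqrt_continuous.
Qed.

Lemma cvg_enorm0 (T : Type) (G : set_system T) {FG : Filter G} (f : T -> 'rV[R]_n) :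
  enorm (f t) @[t --> G] --> (0 : R) -> f @ G --> (0 : 'rV[R]_n).
Proof.
move=> f0; apply: norm_cvg0.
apply: squeeze_cvgr (cvg_cst _) f0.
by near=> t; rewrite normr_ge0 norm_le_enorm.
Unshelve. all: by end_near. Qed.

End inner.

(** * Lower semicontinuity, subgradients and prox *)

(** Without a minimum, the sublevel sets of the values of [f] on [K] still generate a proper filter
    on [K]. At a cluster point [z] some [w] has a smaller value, and semicontinuity keeps [f] above
    [f w] near [z], away from the sublevel set of [w]. *)
Lemma lsc_compact_min (R : realType) (T : topologicalType) (f : T -> \bar R) (K : set T) :
  compact K -> K !=set0 -> lower_semicontinuous f ->
  exists2 z, K z & forall w, K w -> (f z <= f w)%E.
Proof.
move=> cK [w0 Kw0] flsc.
have [[z Kz fz]|nmin] := pselect (exists2 z, K z & forall w, K w -> (f z <= f w)%E).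
  by exists z.
have below z : K z -> exists2 w, K w & (f w < f z)%E.
  move=> Kz; apply: contrapT => nw; apply: nmin; exists z => // w Kw.
  by rewrite leNgt; apply/negP => wz; apply: nw; exists w.
pose B w := [set z | K z /\ (f z <= f w)%E].
have FB : ProperFilter (filter_from K B).
  apply: filter_from_proper; last by move=> w Kw; exists w.
  apply: filter_from_filter => [|u v Ku Kv]; first by exists w0.
  have [uv|vu] := leP (f u) (f v).
    by exists u => // z [Kz zu]; split; split => //; apply: le_trans zu uv.
  by exists v => // z [Kz zv]; split; split => //; apply: le_trans zv (ltW vu).
have [|z [Kz zF]] := cK _ FB; first by exists w0 => // z [].
have [w Kw wz] := below _ Kz.
have [a wa az] : exists2 a : R, (f w <= a%:E)%E & (a%:E < f z)%E.
  move: wz; case: (f w) => [r| |]; case: (f z) => [s| |] //=.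
  - by exists r.
  - by exists r => //; exact: ltry.
  - by exists (s - 1); [rewrite leNye|rewrite lte_fin; lra].
  - by exists 0; [exact: leNye|exact: ltry].
have [V Vz Va] := flsc _ _ az.
have [y [[Ky yw] Vy]] := zF (B w) V (ex_intro2 _ _ w Kw (fun _ h => h)) Vz.
by have := lt_le_trans (Va _ Vy) (le_trans yw wa); rewrite ltxx.
Qed.

Lemma lsc_addr_continuous (R : realType) (T : topologicalType) (f : T -> \bar R) (q : T -> R) :
  lower_semicontinuous f -> continuous q ->
  lower_semicontinuous (fun z => f z + (q z)%:E)%E.
Proof.
move=> flsc qc z a az.
have [b [bz ab]] : exists b : R, (b%:E < f z)%E /\ a - b < q z.
  move: az; case: (f z) => [r| |] //=.
  - rewrite lte_fin => az; exists (r - (r + q z - a) / 2); split; rewrite ?lte_fin; lra.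
  - by move=> _; exists (a - q z + 1); rewrite ltry; split => //; lra.
have [V Vz Vb] := flsc _ _ bz.
exists (V `&` [set y | a - b < q y]).
  apply: filterI => //; exact: (qc z _ (lt_nbhsr ab)).
move=> y [/Vb /=]; case: (f y) => [r| |] //=; last by move=> _ _; exact: ltry.
by rewrite !lte_fin => br qy; lra.
Qed.

Section convex.
Context {R : realType} {n : nat}.
Variable g : 'rV[R]_n -> \bar R.
Hypotheses (g_proper : proper_fun g).
Implicit Types (x y z v w : 'rV[R]_n).

Lemma subdifferential_fin x v : subdifferential g x v -> g x \is a fin_num.
Proof.
case: g_proper => gNy [y gy] /(_ y); have := gNy x; case: (g x) => //= _.
by move: gy; case: (g y).
Qed.

Lemma subdifferential_ge x v z : subdifferential g x v -> g z \is a fin_num ->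
  fine (g x) + inner v (z - x) <= fine (g z).
Proof.
move=> s gz; have := s z; rewrite -{1}(fineK (subdifferential_fin s)) -{1}(fineK gz).
by rewrite -EFinD lee_fin.
Qed.

Lemma subdifferential_closed (u s : nat -> 'rV[R]_n) x v :
  lower_semicontinuous g -> (forall k, subdifferential g (u k) (s k)) ->
  u k @[k --> \oo] --> x -> s k @[k --> \oo] --> v -> subdifferential g x v.
Proof.
move=> g_lsc su ux sv y.
have [gy|] := boolP (g y \is a fin_num); last first.
  by case: g_proper => /(_ y); case: (g y) => //= _ _ _; rewrite leey.
rewrite leNgt; apply/negP => ygx.
have ygx' : ((fine (g y) - inner v (y - x))%R%:E < g x)%E.
  by move: ygx; rewrite -{1}(fineK gy) -lteBlDr// -EFinB.
have [a ya ax] : exists2 a : R, fine (g y) - inner v (y - x) < a & (a%:E < g x)%E.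
  move: ygx'; set b := _ - _; case: (g x) => [r| |] //=.
    by rewrite lte_fin => br; exists ((b + r) / 2); rewrite ?lte_fin; lra.
  by move=> _; exists (b + 1); [lra | exact: ltry].
have [V Vx Va] := g_lsc _ _ ax.
have cv : fine (g y) - inner (s k) (y - u k) @[k --> \oo] --> fine (g y) - inner v (y - x).
  apply: cvgB; first exact: cvg_cst.
  by apply: cvg_inner => //; apply: cvgB => //; exact: cvg_cst.
suff : a <= fine (g y) - inner v (y - x) by rewrite leNgt ya.
apply: (cvgr_to_ge cv).
have : \forall k \near \oo, V (u k) := ux _ Vx.
apply: filterS => k Vk.
have := subdifferential_ge (su k) gy; have := Va _ Vk.
by rewrite -[g (u k)](fineK (subdifferential_fin (su k))) lte_fin; lra.
Qed.

Hypotheses (g_convex : convex_fun g) (g_lsc : lower_semicontinuous g).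

(** A subgradient at [xs] gives an affine minorant of [g], so the objective dominates a coercive
    function [m] that agrees with it at [xs]. Outside the compact set [K] where [m <= m xs] the
    objective exceeds its value at [xs], so a minimiser over [K] is global. *)
Lemma prox_minimizer (t : R) y xs v : 0 < t -> subdifferential g xs v ->
  forall w, (prox_objective t g y (prox t g y) <= prox_objective t g y w)%E.
Proof.
move=> t0 sv; rewrite /prox.
have gxs := subdifferential_fin sv.
suff ex : [set z | forall w, (prox_objective t g y z <= prox_objective t g y w)%E] !=set0.
  exact: (getPex ex).
pose q z := (2 * t)^-1 * enorm (z - y) ^+ 2.
have cB a z : w - a @[w --> z] --> z - a.
  exact: (cvgB (@cvg_id _ (nbhs z)) (cvg_cst a)).
have qc : continuous q.
  have -> : q = fun z => (2 * t)^-1 * inner (z - y) (z - y).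
    by apply: funext => z; rewrite /q enorm_sqr.
  by move=> z; exact: (cvgM (cvg_cst _) (cvg_inner (cB y z) (cB y z))).
pose m z := fine (g xs) + inner v (z - xs) + q z.
have mc : continuous m.
  have -> : m = (fun z => fine (g xs) + inner v (z - xs)) + q by [].
  move=> z.
  have h : inner v (w - xs) @[w --> z] --> inner v (z - xs).
    exact: cvg_inner (cvg_cst v) (cB xs z).
  apply: (cvgD _ (qc z)); exact: (cvgD (cvg_cst (fine (g xs))) h).
have m_le z : ((m z)%:E <= prox_objective t g y z)%E.
  by rewrite /prox_objective /m EFinD leeD2r// EFinD fineK.
pose K := [set z | m z <= m xs].
have Kxs : K xs by rewrite /K /=.
have mxs : prox_objective t g y xs = (m xs)%:E.
  by rewrite /m subrr innerC inner0l addr0 EFinD fineK.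
have cK : compact K.
  apply: bounded_closed_compact; last first.
    have -> : K = m @^-1` [set r | r <= m xs] by [].
    by apply: closed_comp => [z _|]; [exact: mc|exact: closed_le].
  pose C := m xs - fine (g xs) - inner v (y - xs) + t * inner v v.
  (* Young's inequality with weight [2 * t] bounds the linear term of [m] by half of its quadratic
     term, which leaves the other half for coercivity. *)
  have qK z : K z -> (4 * t)^-1 * enorm (z - y) ^+ 2 <= C.
    rewrite /K /= => Kz.
    have t2 : 0 < 2 * t by lra.
    have := inner_young_opp v (z - y) t2.
    have -> : inner v (z - y) = inner v (z - xs) - inner v (y - xs).
      by rewrite -innerBr; congr inner; rewrite opprB addrA subrK.
    move: Kz; rewrite {1}/m /q -!enorm_sqr => Kz.
    have e : (2 * (2 * t))^-1 = (4 * t)^-1 by congr (_ ^-1); ring.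
    move: Kz; have -> : (2 * t)^-1 = 2 * (4 * t)^-1 by field; rewrite gt_eqF.
    rewrite e /C -!enorm_sqr; set U := (4 * t)^-1 * _.
    by rewrite -[2 * _ * _]mulrA -/U; lra.
  have C0 : 0 <= C.
    apply: le_trans (qK _ Kxs); rewrite mulr_ge0 ?sqr_ge0// invr_ge0; lra.
  exists (Num.sqrt (4 * t * C) + enorm y); split; first exact: num_real.
  move=> M hM z /qK Kz; apply: le_trans (ltW hM); apply: le_trans (norm_le_enorm _) _.
  have -> : z = (z - y) + y by rewrite subrK.
  apply: le_trans (enormD _ _) _; rewrite lerD2r.
  rewrite -[leLHS]ger0_norm ?enorm_ge0// -sqrtr_sqr ler_wsqrtr//.
  by move: Kz; rewrite ler_pdivrMl//; lra.
have [z Kz zmin] := lsc_compact_min cK (ex_intro _ _ Kxs) (lsc_addr_continuous g_lsc qc).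
exists z => w /=.
have [Kw|Kw] := pselect (K w); first exact: zmin.
apply: le_trans (zmin _ Kxs) _; rewrite -/(q _).
apply: (@le_trans _ _ (m xs)%:E); first by rewrite -mxs.
apply: le_trans (m_le w); rewrite lee_fin ltW// ltNge; exact/negP.
Qed.

(** The minimiser [z] is compared with [s *: w + (1 - s) *: z]. Convexity and division by [s] give
    [0 <= A + s * B], where [A] is the slack of the subgradient inequality. *)
Lemma prox_subdifferential (t : R) y xs v : 0 < t -> subdifferential g xs v ->
  subdifferential g (prox t g y) (t^-1 *: (y - prox t g y)).
Proof.
move=> t0 sv; have := prox_minimizer y t0 sv; set z := prox t g y => zmin.
have gxs := subdifferential_fin sv.
have [gNy _] := g_proper.
have gz : g z \is a fin_num.
  have := zmin xs; have := gNy z; rewrite /prox_objective -(fineK gxs).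
  by case: (g z) => //=; rewrite -EFinD.
move=> w; have [gw|] := boolP (g w \is a fin_num); last first.
  by move: (gNy w); case: (g w) => //= _ _; rewrite leey.
rewrite -{1}(fineK gz) -{1}(fineK gw) -EFinD lee_fin innerZl.
set A := fine (g w) - fine (g z) + t^-1 * inner (z - y) (w - z).
set B := (2 * t)^-1 * inner (w - z) (w - z).
have B0 : 0 <= B by rewrite mulr_ge0 ?inner_ge0// invr_ge0; lra.
have step s : 0 < s -> s < 1 -> 0 <= A + s * B.
  move=> s0 s1; have := zmin (s *: w + (1 - s) *: z); rewrite /prox_objective => h.
  have := le_trans h (leeD2r _ (g_convex w z s0 s1)).
  rewrite -(fineK gz) -(fineK gw) -!EFinM -!EFinD lee_fin.
  have -> : s *: w + (1 - s) *: z - y = (z - y) + s *: (w - z).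
    by rewrite scalerBl scale1r scalerBr; apply/rowP => i; rewrite !mxE; ring.
  rewrite !enorm_sqr inner_sqrDZ; set D := w - z; set E := z - y => k.
  rewrite -(pmulr_rge0 _ s0).
  have -> : s * (A + s * B) = s * (fine (g w) - fine (g z)) + (2 * t)^-1 * (2 * (s * inner E D) + s * (s * inner D D)).
    by rewrite /A /B -/D -/E; field; rewrite gt_eqF.
  by lra.
have : 0 <= A.
  rewrite leNgt; apply/negP => A0.
  have B1 : 0 < B + 1 - A by lra.
  (* Instead of a limit [s -> 0]: this [s] is small enough for [s * B <= - A / 2]. *)
  have s0 : 0 < - A / (2 * (B + 1 - A)) by rewrite divr_gt0//; lra.
  have s1 : - A / (2 * (B + 1 - A)) < 1 by rewrite ltr_pdivrMr; lra.
  have := step _ s0 s1.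
  have : - A / (2 * (B + 1 - A)) * B <= - A / 2.
    rewrite mulrAC ler_pdivrMr; last lra.
    have : 0 <= - A * (1 - A) by rewrite mulr_ge0; lra.
    by lra.
  by lra.
by rewrite /A -[y - z]opprB innerNl mulrN; lra.
Qed.

End convex.

(** * Local Lipschitz continuity and compactness *)

Section lipschitz.
Context {R : realType} {n : nat}.
Implicit Types (F : 'rV[R]_n -> 'rV[R]_n) (A : set 'rV[R]_n).

Lemma cvg_subr_enorm (T : Type) (G : set_system T) {FG : Filter G}
    (f : T -> 'rV[R]_n) (u : 'rV[R]_n) :
  enorm (f t - u) @[t --> G] --> (0 : R) -> f @ G --> u.
Proof.
move=> /cvg_enorm0 h.
have := cvgD h (cvg_cst u); rewrite add0r.
have e : (fun t => f t - u) + cst u = f by apply: funext => t; exact: subrK.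
by rewrite e; exact.
Qed.

Lemma cvg_enorm_subr (T : Type) (G : set_system T) {FG : Filter G}
    (f : T -> 'rV[R]_n) (u : 'rV[R]_n) :
  f @ G --> u -> enorm (f t - u) @[t --> G] --> (0 : R).
Proof.
move=> fu; have h : f t - u @[t --> G] --> u - u by exact: (cvgB fu (cvg_cst u)).
have -> : 0 = enorm (u - u) by rewrite subrr enorm0.
exact: cvg_enorm h.
Qed.

Lemma locally_lipschitz_continuous F : locally_lipschitz F -> continuous F.
Proof.
move=> lF p; have [A Ap [L [L0 LA]]] := lF p.
have h : L * enorm (w - p) @[w --> p] --> (0 : R).
  have h0 : enorm (w - p) @[w --> p] --> (0 : R).
    exact: (cvg_enorm_subr (@cvg_id _ (nbhs p))).
  have -> : 0 = L * 0 by rewrite mulr0.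
  exact: (cvgM (cvg_cst L) h0).
have nh : \forall w \near p, 0 <= enorm (F w - F p) <= L * enorm (w - p).
  near=> w; rewrite enorm_ge0 /=; apply: LA; last exact: (nbhs_singleton Ap).
  by near: w.
have k : enorm (F w - F p) @[w --> p] --> (0 : R).
  exact: (squeeze_cvgr nh (cvg_cst (0 : R)) h).
exact: (cvg_subr_enorm k).
Unshelve. all: by end_near. Qed.

(** A covering argument on [A * A]: near a diagonal point the local modulus works; near [(p, q)]
    with [p != q] the distance is bounded away from 0 and the increment of [F] is bounded above. *)
Lemma lipschitz_compact F A : locally_lipschitz F -> compact A ->
  exists L, lipschitz_modulus F A L.
Proof.
move=> lF cA; have cF := locally_lipschitz_continuous lF.
have /compact_near_coveringP cov := compact_setX cA cA.
pose P (L : R) (z : 'rV[R]_n * 'rV[R]_n) :=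
  enorm (F z.1 - F z.2) <= L * enorm (z.1 - z.2).
have : \forall L \near +oo, A `*` A `<=` P L.
  apply: cov => -[p q] [/= Ap Aq].
  have [<-{q Aq}|pq] := eqVneq p q.
    have [B Bp [L [L0 LB]]] := lF p.
    exists (B `*` B, [set r | L <= r]) => /=.
      split; first by exists (B, B).
      exact: nbhs_pinfty_ge (num_real _).
    move=> [[y z] r] /= [[By Bz] Lr]; apply: le_trans (LB _ _ By Bz) _.
    by rewrite ler_wpM2r ?enorm_ge0.
  have d0 : 0 < enorm (p - q).
    rewrite lt_neqAle enorm_ge0 andbT eq_sym; apply: contra_neq pq => /enorm_eq0/eqP.
    by rewrite subr_eq0 => /eqP.
  set d := enorm (p - q) in d0; set e := enorm (F p - F q) + 1.
  have c1 : (fun z : 'rV[R]_n * 'rV[R]_n => z.1) @ (p, q) --> p by exact: cvg_fst.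
  have c2 : (fun z : 'rV[R]_n * 'rV[R]_n => z.2) @ (p, q) --> q by exact: cvg_snd.
  have cd : enorm (z.1 - z.2) @[z --> (p, q)] --> d by apply: cvg_enorm; exact: cvgB.
  have ce : enorm (F z.1 - F z.2) @[z --> (p, q)] --> enorm (F p - F q).
    apply: cvg_enorm; apply: cvgB.
      exact: (cvg_comp _ _ c1 (cF p)).
    exact: (cvg_comp _ _ c2 (cF q)).
  exists ([set z | e > enorm (F z.1 - F z.2)] `&` [set z | d / 2 < enorm (z.1 - z.2)], [set r | e / (d / 2) <= r]) => /=.
    split; last exact: nbhs_pinfty_ge (num_real _).
    apply: filterI.
      by apply: (cvgr_lt _ ce); rewrite /e ltrDl.
    by apply: (cvgr_gt _ cd); lra.
  move=> [[y z] r] /= [[h1 h2] h3]; rewrite /P /=.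
  apply: le_trans (ltW h1) _.
  have e0 : 0 <= e by rewrite addr_ge0 ?enorm_ge0.
  have d2 : 0 < d / 2 by lra.
  have r0 : 0 <= r by apply: le_trans h3; rewrite divr_ge0// ltW.
  rewrite ler_pdivrMr// in h3; apply: le_trans h3 _.
  by rewrite ler_wpM2l// ltW.
move=> /(filterI (nbhs_pinfty_ge (num_real 0))) /filter_ex [L [L0 LP]].
by exists L; split => // y z Ay Az; exact: (LP (y, z) (conj Ay Az)).
Qed.

Lemma enorm_ball_compact (M : R) : compact [set z : 'rV[R]_n | enorm z <= M].
Proof.
apply: bounded_closed_compact.
  exists M; split; first exact: num_real.
  by move=> N MN z /= zM; apply: le_trans (norm_le_enorm _) (le_trans zM (ltW MN)).
have -> : [set z : 'rV[R]_n | enorm z <= M] = enorm @^-1` [set r | r <= M] by [].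
apply: closed_comp => [z _|]; last exact: closed_le.
exact: (cvg_enorm (@cvg_id _ (nbhs z))).
Qed.

Lemma enorm_conv (t M : R) (u v : 'rV[R]_n) : 0 <= t -> t <= 1 ->
  enorm u <= M -> enorm v <= M -> enorm (t *: u + (1 - t) *: v) <= M.
Proof.
move=> t0 t1 uM vM; have t1' : 0 <= 1 - t by lra.
apply: le_trans (enormD _ _) _; rewrite !enormZ !ger0_norm//.
have := ler_wpM2l t0 uM; have := ler_wpM2l t1' vM; lra.
Qed.

Lemma enorm_ball_convex (M : R) :
  convex_set ([set z | enorm z <= M] : set (convex_lmodType 'rV[R]_n)).
Proof.
apply/convex_setW => u v; rewrite !inE /= => uM vM k k0 k1; rewrite inE /=.
change (enorm (k%:num *: u + (1 - k%:num) *: v) <= M).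
by apply: enorm_conv => //; exact: ltW.
Qed.

(** A modulus may be enlarged at will; [s] will be [sqrt al * L0], so that [L] also controls the
    initial parameter. *)
Lemma hull_modulus_exists F (x : nat -> 'rV[R]_n) (M s : R) :
  locally_lipschitz F -> (forall k, enorm (x k) <= M) ->
  exists A L, hull_modulus F x A L /\ s <= L.
Proof.
move=> lF xM; have cA := @enorm_ball_compact M.
have [L [L0 LA]] := lipschitz_compact lF cA.
exists [set z | enorm z <= M], (Num.max L s); split; last by rewrite le_max lexx orbT.
split => //; first exact: enorm_ball_convex.
split => [|y z Ay Az]; first by rewrite le_max L0.
by apply: le_trans (LA _ _ Ay Az) _; rewrite ler_wpM2r ?enorm_ge0// le_max lexx.
Qed.

(** [j <= phi j] replaces strict monotonicity of [phi]: it is all that is required to pass limits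
    along [phi]. *)
Lemma bounded_subseq (u : nat -> 'rV[R]_n) (M : R) : (forall k, enorm (u k) <= M) ->
  exists (p : 'rV[R]_n) (phi : nat -> nat), (forall j, (j <= phi j)%N) /\ u (phi j) @[j --> \oo] --> p.
Proof.
move=> uM; have cA := @enorm_ball_compact M.
have uA : (u k @[k --> \oo]) [set z | enorm z <= M] by exists 0%N => // k _ /=; exact: uM.
have [p [_ pc]] := cA _ _ uA.
have ex j : exists k, (j <= k)%N /\ `|u k - p| < j.+1%:R^-1.
  have Bp : nbhs p [set z | `|z - p| < j.+1%:R^-1].
    apply/nbhs_ballP; exists j.+1%:R^-1 => /=; first by rewrite invr_gt0.
    by move=> z; rewrite -ball_normE /= distrC.
  have [_ [[k jk <-] kB]] := pc [set u k | k in [set k | (j <= k)%N]] _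
    (ex_intro2 _ _ j I (fun k jk => ex_intro2 _ _ k jk erefl)) Bp.
  by exists k.
have [phi phiP] := choice ex.
exists p, phi; split => [j|]; first by have [] := phiP j.
apply/cvgrPdist_lt => e e0; near=> j.
rewrite distrC; apply: lt_trans (phiP j).2 _.
by near: j; exact: near_infty_natSinv_lt (PosNum e0).
Unshelve. all: by end_near. Qed.

End lipschitz.

(** * One step of the descent *)

Section descent.
Context {R : realType} {n : nat}.
Implicit Types (a b p f D E : 'rV[R]_n).

(** Three cross terms remain after expanding [inner w w]: the one in [inner D a] has a favourable
    sign by monotonicity; those in [inner E a] sum to the factor [al * (2 - al) * r^2] and take
    Young's weight [e]; the one in [inner E D] takes weight [m]. *)
Lemma quadratic_bound (al c r t m e d l : R) a D E w :
  1 <= al -> al <= 2 -> 0 <= r -> 0 <= t -> 0 < m -> 0 < e ->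
  (al * r) ^+ 2 * (1 + (2 - al) / (2 * al * e) + m^-1) <= l ->
  (1 - al) * r ^+ 2 - 2^-1 + al * (2 - al) * r ^+ 2 * e / 2 +
    c ^+ 2 * ((1 + m) * (1 + al * r) ^+ 2 + l * r ^+ 2) <= - d ->
  t ^+ 2 * inner D D <= c ^+ 2 * inner a a -> 0 <= inner D a ->
  w = r *: a - (t * (1 + al * r)) *: D + (al * r) *: E ->
  inner w w - al * r ^+ 2 * inner a a - al ^+ 2 * r ^+ 2 * inner E a
    + l * (t * r) ^+ 2 * inner D D <= (2^-1 - d) * inner a a + l * inner E E.
Proof.
move=> al1 al2 r0 t0 m0 e0 hl hc hD Da wdef.
have EE := inner_ge0 E; have aa := inner_ge0 a; have DD := inner_ge0 D.
have wE : inner w w = r ^+ 2 * inner a a + t ^+ 2 * (1 + al * r) ^+ 2 * inner D D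
   + (al * r) ^+ 2 * inner E E - 2 * (r * t * (1 + al * r)) * inner D a
   + 2 * al * r ^+ 2 * inner E a - 2 * (al * r * (1 + al * r) * t) * inner E D.
  by rewrite wdef !innerE (innerC a D) (innerC a E) (innerC D E); ring.
have ar0 : 0 <= al * r by rewrite mulr_ge0//; lra.
have y1 : (al * (2 - al) * r ^+ 2) * inner E a <=
   (al * (2 - al) * r ^+ 2) * (e / 2 * inner a a + (2 * e)^-1 * inner E E).
  rewrite ler_wpM2l//; first by rewrite !mulr_ge0 ?exprn_ge0; lra.
  by rewrite innerC; exact: inner_young.
have y2 : - (2 * (al * r * (1 + al * r) * t) * inner E D) <=
   m * (t ^+ 2 * (1 + al * r) ^+ 2 * inner D D) + (al * r) ^+ 2 / m * inner E E.
  have := inner_young_opp ((t * (1 + al * r)) *: D) ((al * r) *: E) m0.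
  rewrite !innerE (innerC D E).
  have -> : (2 * m)^-1 = m^-1 / 2 by field; rewrite gt_eqF.
  by lra.
have y3 := ler_wpM2r EE hl.
have y4 : 0 <= 2 * (r * t * (1 + al * r)) * inner D a.
  by rewrite !mulr_ge0//; lra.
have y5 := ler_wpM2r aa hc.
have l0 : 0 <= l.
  apply: le_trans hl; rewrite mulr_ge0 ?sqr_ge0// !addr_ge0 ?invr_ge0// ?divr_ge0 ?mulr_ge0; lra.
have q0 : 0 <= (1 + m) * (1 + al * r) ^+ 2 + l * r ^+ 2.
  by rewrite addr_ge0 ?mulr_ge0 ?sqr_ge0//; lra.
have y6 := ler_wpM2l q0 hD.
have e1 : (al * r) ^+ 2 * (1 + (2 - al) / (2 * al * e) + m^-1) =
  (al * r) ^+ 2 + al * (2 - al) * r ^+ 2 * (2 * e)^-1 + (al * r) ^+ 2 / m.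
  by field; rewrite !gt_eqF//; lra.
rewrite e1 in y3; rewrite wE.
set A1 := (al * r) ^+ 2 / m in y2 y3 *.
set A2 := (2 * e)^-1 in y1 y3 *.
clear wE wdef hl hc e1 hD.
by lra.
Qed.

(** Here [a], [b] are two successive increments, [p = x_(k+1) - z] and [f = F x_k]; [G1], [G0],
    [G'], [Gs] are the values of [g] at [x_k], [x_(k+1)], [x_(k+2)], [z]. The first two subgradient
    inequalities are at [x_(k+2)], tested at [z] and [x_(k+1)]; the last two are at [x_(k+1)],
    tested at [x_(k+2)] and [x_k]. *)
Lemma descent_abstract (al c r t m e d l G' G0 G1 Gs : R) a b p f D E :
  1 <= al -> al <= 2 -> 0 <= r -> 0 <= t -> 0 < m -> 0 < e ->
  (al * r) ^+ 2 * (1 + (2 - al) / (2 * al * e) + m^-1) <= l ->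
  (1 - al) * r ^+ 2 - 2^-1 + al * (2 - al) * r ^+ 2 * e / 2 +
    c ^+ 2 * ((1 + m) * (1 + al * r) ^+ 2 + l * r ^+ 2) <= - d ->
  t ^+ 2 * inner D D <= c ^+ 2 * inner a a -> 0 <= inner D a ->
  t * (G' - Gs) + inner (b + t *: (f + D) + (al * r * t) *: D) (p + b) <= 0 ->
  t * (G' - G0) + inner (b + t *: (f + D) + (al * r * t) *: D) b <= 0 ->
  t * (G0 - G') - inner (r *: a + t *: f + (al * r) *: E) b <= 0 ->
  t * (G0 - G1) + inner (r *: a + t *: f + (al * r) *: E) a <= 0 ->
  2^-1 * inner (p + b) (p + b) + 2^-1 * inner b b + l * (t * r) ^+ 2 * inner D D
    + (1 + al * r) * t * (G0 - Gs + inner (f + D) p) + d * inner a a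
  <= 2^-1 * inner p p + 2^-1 * inner a a + l * inner E E
    + al * r * t * (G1 - Gs - inner f (a - p)).
Proof.
move=> al1 al2 r0 t0 m0 e0 hl hc hD Da I1 I2 I3 I4.
pose w := r *: a - (t * (1 + al * r)) *: D + (al * r) *: E.
have := quadratic_bound al1 al2 r0 t0 m0 e0 hl hc hD Da (erefl w) => Q.
(* Adding [I2] and [I3] cancels the values of [g]: this is monotonicity of the subdifferential
   between consecutive iterates. *)
have bw : inner b b <= inner w b.
  by move: I2 I3; rewrite /w !innerE; lra.
have wb : inner w b <= inner w w.
  by have := inner_ge0 (w - b); rewrite innerBl !innerBr (innerC b w); lra.
have ar0 : 0 <= al * r by rewrite mulr_ge0//; lra.
have I4' := ler_wpM2l ar0 I4.
have key : 2^-1 * inner (p + b) (p + b) + 2^-1 * inner b b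
    + (1 + al * r) * t * (G0 - Gs + inner (f + D) p)
  <= 2^-1 * inner p p + al * r * t * (G1 - Gs - inner f (a - p)) + inner w b
     - al * r ^+ 2 * inner a a - al ^+ 2 * r ^+ 2 * inner E a.
  move: I1 I3 I4'; rewrite /w !innerE (innerC b p); lra.
by lra.
Qed.

End descent.

(** * Stepsizes *)

(** The product form [s * l <= c] covers [l = 0], where the quotient is [+oo] and drops out of the
    minimum. *)
Lemma eq_min_stepsize (R : realType) (s A B c l : R) : 0 < A -> 0 < B -> 0 < c -> 0 <= l ->
  s%:E = Order.min A%:E (Order.min B%:E (c%:E / l%:E)%E) ->
  [/\ 0 < s, s <= A, s <= B, s * l <= c & [\/ s = A, s = B | s * l = c]].
Proof.
move=> A0 B0 c0; rewrite le_eqVlt => /orP[/eqP <-|l0].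
  rewrite inve0 gt0_muley ?lte_fin// [Order.min _ +oo%E]min_l ?leey// -EFin_min => -[->].
  rewrite mulr0; have [AB|BA] := leP A B; split; try lra; first by constructor 1.
  by constructor 2.
rewrite inver gt_eqF// -EFinM -!EFin_min => -[->].
have cl0 : 0 < c / l by rewrite divr_gt0.
split.
- by rewrite !lt_min A0 B0.
- by rewrite ge_min lexx.
- by rewrite !ge_min lexx orbT.
- by rewrite -ler_pdivlMr// !ge_min lexx !orbT.
- have [_|_] := leP A (Num.min B (c / l)); first by constructor 1.
  have [_|_] := leP B (c / l); first by constructor 2.
  by constructor 3; rewrite mulfVK// gt_eqF.
Qed.

Section stepsize.
Context {R : realType}.
Variables (al c L : R) (gamma rho ell : nat -> R).
Hypotheses (al1 : 1 <= al) (al2 : al <= 2) (c0 : 0 < c) (L_ge0 : 0 <= L).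
Hypothesis gamma_gt0 : forall k, 0 < gamma k.
Hypothesis rhoE : forall k, rho k.+1 = gamma k.+1 / gamma k.
Hypothesis rho0 : rho 0%N = 1.
Hypothesis gamma_cases : forall k,
  [\/ gamma k.+1 = gamma k * Num.sqrt (al^-1 + rho k),
      gamma k.+1 = (2 / 3 + 2 * al / 5) * gamma k | gamma k.+1 * ell k = c].
Hypothesis ell0_gt0 : 0 < ell 0%N.
Hypothesis ell_le : forall k, (0 < k)%N -> ell k <= L.

Let gammaS k : gamma k.+1 = rho k.+1 * gamma k.
Proof. by rewrite rhoE mulfVK// gt_eqF. Qed.

Let rho_gt0 k : 0 < rho k.
Proof. by case: k => [|k]; rewrite ?rho0// rhoE divr_gt0. Qed.

Let gamma_ge k s : s <= rho k.+1 -> s * gamma k <= gamma k.+1.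
Proof. by move=> h; rewrite gammaS ler_wpM2r// ltW. Qed.

Let rho_cases k :
  [\/ rho k.+1 = Num.sqrt (al^-1 + rho k), rho k.+1 = 2 / 3 + 2 * al / 5 | gamma k.+1 * ell k = c].
Proof.
case: (gamma_cases k) => h; [constructor 1|constructor 2|by constructor 3];
by rewrite rhoE h; field; rewrite gt_eqF.
Qed.

Let sqrt_ge (s k : R) : 0 <= s -> s ^+ 2 <= k -> s <= Num.sqrt k.
Proof. by move=> s0 sk; rewrite -[leLHS]ger0_norm// -sqrtr_sqr ler_wsqrtr. Qed.

Let al0 : 0 < al. Proof. exact: lt_le_trans al1. Qed.
Let alV : al * al^-1 = 1. Proof. by apply: divff; rewrite gt_eqF. Qed.
Let alV_ge : 2^-1 <= al^-1. Proof. by rewrite lef_pV2 ?posrE. Qed.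
Let alV_le1 : al^-1 <= 1. Proof. by rewrite invf_le1. Qed.

Let sqrt_al_ge1 : 1 <= Num.sqrt al.
Proof. by apply: sqrt_ge => //; rewrite expr1n. Qed.

(** The other two branches give ratios at least [1 / al] and at least 1, and [1 / al >= 1 - 1 / al]
    because [al <= 2]. *)
Lemma stepsize_reset k : rho k < 1 - al^-1 ->
  exists2 j, k = j.+1 & gamma k * ell j = c.
Proof.
have [a1 a2 av1 av2] : [/\ 1 <= al, al <= 2, 2^-1 <= al^-1 & al^-1 <= 1] by [].
have cp := c0.
case: k => [|j]; first by rewrite rho0; lra.
case: (rho_cases j) => [->|->|h] h1; last by exists j.
  have : al^-1 <= Num.sqrt (al^-1 + rho j).
    apply: sqrt_ge; first by lra.
    have := rho_gt0 j; have : al^-1 ^+ 2 <= al^-1 by rewrite expr2 ler_piMl; lra.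
    by lra.
  by lra.
by lra.
Qed.

Lemma stepsize_drop k : gamma k.+1 = gamma k * Num.sqrt (al^-1 + rho k) ->
  gamma k <= gamma k.+1 * Num.sqrt al.
Proof.
have [a1 a2 av1 av2] : [/\ 1 <= al, al <= 2, 2^-1 <= al^-1 & al^-1 <= 1] by [].
have cp := c0.
move=> ->; rewrite -mulrA -sqrtrM; last by rewrite addr_ge0 ?invr_ge0 ?ltW//; lra.
apply: ler_peMr; first exact: ltW.
apply: sqrt_ge => //.
by rewrite mulrDl [_^-1 * al]mulrC alV expr1n lerDl ltW// mulr_gt0.
Qed.

Lemma stepsize_incr k : 1 - al^-1 <= rho k -> gamma k <= gamma k * Num.sqrt (al^-1 + rho k).
Proof.
have [a1 a2 av1 av2] : [/\ 1 <= al, al <= 2, 2^-1 <= al^-1 & al^-1 <= 1] by [].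
have cp := c0.
move=> h; apply: ler_peMr; first exact: ltW.
by apply: sqrt_ge => //; rewrite expr1n; lra.
Qed.

Let theta_incr k : gamma k <= (2 / 3 + 2 * al / 5) * gamma k.
Proof. by have a1 := al1; apply: ler_peMl; [exact: ltW|lra]. Qed.

Let first_step : gamma 0%N * ell 0%N <= c -> gamma 1%N * ell 0%N = c -> gamma 0%N <= gamma 1%N.
Proof. by move=> h e; rewrite -(ler_pM2r ell0_gt0) e. Qed.

Let first_rho : gamma 0%N <= gamma 1%N -> 1 <= rho 1%N.
Proof. by rewrite rhoE ler_pdivlMr// mul1r. Qed.

(** The factor [sqrt al] pays for one square-root step that follows a step with
    [gamma k * ell j = c]; every other decrease restarts the bound with [L] itself. *)
Lemma stepsize_ge : gamma 0%N * ell 0%N <= c \/ ell 0%N <= L ->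
  forall k, gamma 0%N <= gamma k \/ c <= gamma k * (Num.sqrt al * L).
Proof.
have [a1 a2 av1 av2] : [/\ 1 <= al, al <= 2, 2^-1 <= al^-1 & al^-1 <= 1] by [].
have cp := c0.
move=> init; elim => [|k IH]; first by left.
have up : gamma k <= gamma k.+1 -> gamma 0%N <= gamma k.+1 \/ c <= gamma k.+1 * (Num.sqrt al * L).
  move=> h; case: IH => IH; [left|right]; apply: le_trans IH _ => //.
  by rewrite ler_wpM2r// mulr_ge0//; lra.
have bnd s j : ell j <= L -> gamma s * ell j = c -> c <= gamma s * L.
  by move=> h e; rewrite -[leLHS]e ler_wpM2l// ltW.
have sL : L <= Num.sqrt al * L by rewrite ler_peMl.
case: (gamma_cases k) => h; last first.
- case: k IH up h => [|k] IH up h; last first.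
    right; apply: le_trans (bnd _ _ _ h) _; first exact: ell_le.
    by rewrite ler_wpM2l// ltW.
  case: init => h0; first by left; exact: first_step.
  by right; apply: le_trans (bnd _ _ _ h) _ => //; rewrite ler_wpM2l// ltW.
- by apply: up; rewrite h; exact: theta_incr.
- have [rk|rk] := leP (1 - al^-1) (rho k); first by apply: up; rewrite h; exact: stepsize_incr.
  have dr := stepsize_drop h.
  have [j kj hj] := stepsize_reset rk.
  have [ejL|] := boolP (ell j <= L).
    right; apply: le_trans (bnd _ _ ejL hj) _.
    by rewrite mulrA ler_wpM2r.
  (* Only [ell 0] escapes [ell_le]. If [gamma 0 * ell 0 <= c], the first ratio is at least 1, which
     contradicts [rk]. *)
  case: j kj hj => [|j] kj hj; last by rewrite ell_le.
  case: init => [h0 _|-> //].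
  rewrite kj in rk hj; have := first_rho (first_step h0 hj).
  by have : 0 < al^-1 by [lra]; lra.
Qed.

(** * Average of the stepsizes *)

Variable m : R.
Hypotheses (m_ge0 : 0 <= m) (m_le0 : m <= gamma 0%N) (mL : m * L <= c).

Hypothesis init : gamma 0%N * ell 0%N <= c \/ Num.sqrt al * ell 0%N <= L.

Let le_of_ell s : 0 < s -> c <= s * L -> m <= s.
Proof.
move=> s0 cs; have L0 : 0 < L.
  rewrite lt_neqAle L_ge0 andbT; apply/eqP => L0.
  by move: cs; rewrite -L0 mulr0 leNgt c0.
by rewrite -(ler_pM2r L0); apply: le_trans mL cs.
Qed.

Let ell0_le : Num.sqrt al * ell 0%N <= L -> ell 0%N <= L.
Proof. by apply: le_trans; apply: ler_peMl => //; exact: ltW. Qed.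

Lemma stepsize_reset_ge k : gamma k.+1 * ell k = c -> m <= gamma k.+1.
Proof.
case: k => [|k] h.
  case: init => [h0|/ell0_le h0]; first exact: le_trans m_le0 (first_step h0 h).
  by apply: le_of_ell => //; rewrite -[leLHS]h ler_wpM2l// ltW.
by apply: le_of_ell => //; rewrite -[leLHS]h ler_wpM2l ?ell_le// ltW.
Qed.

(** Below [m] the branch [c / ell k] is excluded, so the ratio is bounded below by the two other
    terms alone. *)
Lemma stepsize_below_ge k t : gamma k.+1 < m -> 0 <= t -> t <= 2 / 3 + 2 * al / 5 ->
  t ^+ 2 <= al^-1 + rho k -> t <= rho k.+1.
Proof.
move=> km t0 t1 t2; case: (rho_cases k) => [->|->//|/stepsize_reset_ge]; first exact: sqrt_ge.
by rewrite leNgt km.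
Qed.

(** A run below [m] can only start with a square-root step. That [k] is at least 2 ensures that the
    large stepsize [gamma k.-1] is itself a term of the sum [T]. *)
Lemma stepsize_below_start k : m <= gamma k -> gamma k.+1 < m ->
  rho k < 1 - al^-1 /\ exists j, k = j.+2.
Proof.
have [a1 a2 av1 av2] : [/\ 1 <= al, al <= 2, 2^-1 <= al^-1 & al^-1 <= 1] by [].
have cp := c0.
move=> mk km; case: (gamma_cases k) => h.
- have [rk|rk] := leP (1 - al^-1) (rho k).
    by have := stepsize_incr rk; rewrite -h; lra.
  split => //; have [j kj hj] := stepsize_reset rk.
  case: j kj hj => [|j] kj hj; last by exists j.
  have dr := stepsize_drop h.
  rewrite kj in rk hj dr km.
  (* For [k = 1] the previous stepsize was set by [ell 0]; the factor [sqrt al] in [init] absorbs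
     the loss of the square-root step. *)
  case: init => [h0|h0].
    have := first_rho (first_step h0 hj).
    by have : 0 < al^-1 by [lra]; lra.
  have : m <= gamma 2%N.
    apply: le_of_ell => //; rewrite -[leLHS]hj.
    apply: le_trans (ler_wpM2r (ltW ell0_gt0) dr) _.
    by rewrite -mulrA ler_wpM2l// ltW.
  by rewrite leNgt km.
- by have := theta_incr k; rewrite -h; lra.
- by have := stepsize_reset_ge h; rewrite leNgt km.
Qed.

Let T k := \sum_(1 <= i < k.+1) (gamma i - m).

Let T_S k : T k.+1 = T k + (gamma k.+1 - m).
Proof. by rewrite /T big_nat_recr. Qed.

(* Before a run of stepsizes below [m] there is an even larger stepsize, because the run
   starts after a ratio [rho k < 1 - al^-1].  The surplus it leaves dominates the deficits
   still to come, as the ratios grow again along the run. *)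
Definition deficit_covered k :=
  al < 3 / 2 /\ [/\ 81 / 100 * m <= gamma k, 81 / 100 <= rho k & 3 * (m - gamma k) <= T k] \/
  3 / 2 <= al /\ ([/\ 7 / 10 * m <= gamma k, 7 / 10 <= rho k & gamma k <= T k] \/
    [/\ 76 / 100 * m <= gamma k, 1 <= rho k & 3 / 2 * (m - gamma k) <= T k]).

Lemma deficit_covered_start k : m <= gamma k -> gamma k.+1 < m ->
  (forall j, (j <= k)%N -> 0 <= T j) -> deficit_covered k.+1 /\ 0 <= T k.+1.
Proof.
have [a1 a2 av1 av2] : [/\ 1 <= al, al <= 2, 2^-1 <= al^-1 & al^-1 <= 1] by [].
have cp := c0; have m0 := m_ge0; have avE := alV.
move=> mk km Tpos; have [rk [j kj]] := stepsize_below_start mk km.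
have r0 := rho_gt0 k.
have TE : T k.+1 = T j + (gamma j.+1 - m) + (gamma k - m) + (gamma k.+1 - m).
  by rewrite T_S kj !T_S.
have Tj : 0 <= T j by apply: Tpos; rewrite kj -addn2 leq_addr.
have gE : gamma k = rho k * gamma j.+1 by rewrite kj gammaS.
have gj := gamma_gt0 j.+1.
have g1 := gamma_gt0 k.+1.
(* The ratio [rho k < 1 - 1 / al] is below 1/3 or 1/2, so [gamma j.+1] exceeds three or two times
   [gamma k]. The constants 81/100 and 7/10 are rationals below [sqrt (2 / 3)] and
   [sqrt (1 / 2)]. *)
have [al3|al3] := ltP al (3 / 2).
  have av3 : 2 / 3 <= al^-1 by nra.
  have r81 : 81 / 100 <= rho k.+1 by apply: stepsize_below_ge => //; lra.
  have gk := gamma_ge r81.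
  have : rho k * gamma j.+1 <= 1 / 3 * gamma j.+1 by rewrite ler_wpM2r ?ltW//; lra.
  rewrite -gE => gj3; rewrite /deficit_covered TE.
  by split; [left; split => //; split|]; lra.
have av3 : al^-1 <= 2 / 3 by nra.
have r7 : 7 / 10 <= rho k.+1 by apply: stepsize_below_ge => //; lra.
have gk := gamma_ge r7.
have : rho k * gamma j.+1 <= 1 / 2 * gamma j.+1 by rewrite ler_wpM2r ?ltW//; lra.
rewrite -gE => gj3; rewrite /deficit_covered TE.
by split; [right; split => //; left; split|]; lra.
Qed.

(** The lower bounds on the new ratio are the linear term at [al = 1], then rationals below
    [sqrt (1 / 2 + 7 / 10)] and [sqrt (1 / 2 + 1)]. In the first case the invariant survives as soon
    as [gamma k >= 15 / 19 * m], which 81/100 ensures. *)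
Lemma deficit_covered_step k : gamma k < m -> gamma k.+1 < m ->
  deficit_covered k -> deficit_covered k.+1 /\ 0 <= T k.+1.
Proof.
have [a1 a2 av1 av2] : [/\ 1 <= al, al <= 2, 2^-1 <= al^-1 & al^-1 <= 1] by [].
have m0 := m_ge0; have avE := alV.
move=> km km' [[al3 [gk rk Tk]]|[al3 [[gk rk Tk]|[gk rk Tk]]]]; rewrite /deficit_covered T_S.
- have av3 : 2 / 3 <= al^-1 by nra.
  have r' : 16 / 15 <= rho k.+1 by apply: stepsize_below_ge => //; lra.
  have := gamma_ge r'; set u := gamma k.+1 in km' *; set v := rho k.+1 in r' *; move=> gk'.
  by split; [left; split => //; split|]; lra.
- have r' : 109 / 100 <= rho k.+1 by apply: stepsize_below_ge => //; lra.
  have := gamma_ge r'; set u := gamma k.+1 in km' *; set v := rho k.+1 in r' *; move=> gk'.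
  by split; [right; split => //; right; split|]; lra.
- have r' : 122 / 100 <= rho k.+1 by apply: stepsize_below_ge => //; lra.
  have := gamma_ge r'; set u := gamma k.+1 in km' *; set v := rho k.+1 in r' *; move=> gk'.
  by split; [right; split => //; right; split|]; lra.
Qed.

Lemma stepsize_average K : K%:R * m <= \sum_(1 <= k < K.+1) gamma k.
Proof.
suff : 0 <= T K.
  by rewrite /T sumrB sumr_const_nat subSS subn0 subr_ge0 mulr_natl.
suff : 0 <= T K /\ (gamma K < m -> deficit_covered K) by case.
elim/ltn_ind: K => -[|k] IH.
  by split; [rewrite /T big_nil|rewrite ltNge m_le0].
have [mk'|km'] := leP m (gamma k.+1).
  split; last by [].
  by rewrite T_S addr_ge0 ?subr_ge0//; case: (IH k).
have [mk|km] := leP m (gamma k).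
  have [|h1 h2] := deficit_covered_start mk km'; last by split.
  by move=> j jk; case: (IH j).
have [//|_ /(_ km) cov] := IH k.
by have [h1 h2] := deficit_covered_step km km' cov; split.
Qed.

End stepsize.

(** * Iterates *)

Section iterates.
Context {R : realType} {n : nat}.
Variables (F : 'rV[R]_n -> 'rV[R]_n) (g : 'rV[R]_n -> \bar R).
Hypotheses (F_monotone : monotone_op F) (F_lipschitz : locally_lipschitz F).
Hypotheses (g_proper : proper_fun g) (g_convex : convex_fun g).
Hypothesis g_lsc : lower_semicontinuous g.
Variables (al c L0 : R).
Hypotheses (al1 : 1 <= al) (al2 : al <= 2) (cE : c = (7 - al)^-1) (L0_gt0 : 0 < L0).
Variables (x : nat -> 'rV[R]_n) (gamma rho : nat -> R).
Hypotheses (gamma_init : 0 < gamma 0%N) (rho_init : rho 0%N = 1).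
Hypothesis gammaE : forall k, (gamma k.+1)%:E = next_stepsize F x al c L0 gamma rho k.
Hypothesis rhoE : forall k, rho k.+1 = gamma k.+1 / gamma k.
Hypothesis xE : forall k, x k.+1 =
  prox (gamma k.+1) g (x k - gamma k.+1 *: extrapolation F x al rho k).
Hypothesis zer_nonempty : zer (sum_op F g) !=set0.

Let beta := cst_beta al.
Definition dx k := x k - x k.-1.
Definition dF k := F (x k) - F (x k.-1).

Lemma zer_subdifferential z : zer (sum_op F g) z <-> subdifferential g z (- F z).
Proof.
split; last by move=> s; exists (- F z) => //; rewrite subrr.
by move=> [v gv /eqP]; rewrite addrC addr_eq0 => /eqP <-.
Qed.

Lemma step_const_gt0 : 0 < c.
Proof. by have a2 := al2; rewrite cE invr_gt0; lra. Qed.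

Lemma lip_estimate_ge0 k : 0 <= lip_estimate F x L0 k.
Proof. by case: k => [|k] /=; [exact: ltW|rewrite divr_ge0 ?enorm_ge0]. Qed.

Lemma stepsize_facts k : [/\ 0 < gamma k, 0 < rho k & [/\
  gamma k.+1 <= gamma k * Num.sqrt (al^-1 + rho k),
  gamma k.+1 <= (2 / 3 + 2 * al / 5) * gamma k,
  gamma k.+1 * lip_estimate F x L0 k <= c &
  [\/ gamma k.+1 = gamma k * Num.sqrt (al^-1 + rho k),
      gamma k.+1 = (2 / 3 + 2 * al / 5) * gamma k
    | gamma k.+1 * lip_estimate F x L0 k = c]]].
Proof.
have [a1 a2] : 1 <= al /\ al <= 2 by [].
have al0 : 0 < al^-1 by rewrite invr_gt0; lra.
have facts j : 0 < gamma j -> 0 < rho j -> 0 < gamma j * Num.sqrt (al^-1 + rho j) /\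
    0 < (2 / 3 + 2 * al / 5) * gamma j.
  by move=> g0 r0; rewrite !mulr_gt0 ?sqrtr_gt0 ?addr_gt0//; lra.
have [g0 r0] : 0 < gamma k /\ 0 < rho k.
  elim: k => [|k [g0 r0]]; first by rewrite rho_init.
  have [A0 B0] := facts k g0 r0.
  have [g1 _ _ _ _] := eq_min_stepsize A0 B0 step_const_gt0 (lip_estimate_ge0 k) (gammaE k).
  by rewrite rhoE divr_gt0.
have [A0 B0] := facts k g0 r0.
by have [g1 h1 h2 h3 h4] := eq_min_stepsize A0 B0 step_const_gt0 (lip_estimate_ge0 k) (gammaE k).
Qed.

Lemma gamma_gt0 k : 0 < gamma k. Proof. by case: (stepsize_facts k). Qed.

Lemma rho_gt0 k : 0 < rho k. Proof. by case: (stepsize_facts k). Qed.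

Lemma gammaS k : gamma k.+1 = rho k.+1 * gamma k.
Proof. by rewrite rhoE mulfVK// gt_eqF// gamma_gt0. Qed.

Lemma rhoS_sqr k : al * rho k.+1 ^+ 2 <= 1 + al * rho k.
Proof.
have a1 := al1; have r0 := rho_gt0 k; have r1 := rho_gt0 k.+1.
have [_ _ [h _ _ _]] := stepsize_facts k.
have h1 : rho k.+1 <= Num.sqrt (al^-1 + rho k).
  by rewrite rhoE ler_pdivrMr ?gamma_gt0// mulrC.
have al0 : 0 < al^-1 by rewrite invr_gt0; lra.
have h2 : rho k.+1 ^+ 2 <= al^-1 + rho k.
  rewrite -[leRHS]sqr_sqrtr; last by lra.
  by rewrite lerXn2r ?nnegrE ?sqrtr_ge0// ltW.
have h3 : al * (al^-1 + rho k) = 1 + al * rho k by rewrite mulrDr divff//; lra.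
by rewrite -h3 ler_wpM2l//; lra.
Qed.

Lemma rho_le_beta k : rho k <= beta.
Proof.
have a1 := al1; have [b1 _ _ bmax] := cst_beta_spec al1 al2.
elim: k => [|k IH]; first by rewrite rho_init.
apply: bmax; first exact/ltW/rho_gt0.
  have [_ _ [_ h _ _]] := stepsize_facts k.
  by rewrite rhoE ler_pdivrMr ?gamma_gt0.
by exists (rho k) => //; exact: rhoS_sqr.
Qed.

(** This is the purpose of the square-root term in the stepsize rule: the descent consumes no more
    of a gap than the previous Lyapunov value contains. *)
Lemma gap_weight_ge0 k : 0 <= (1 + al * rho k) * gamma k - al * rho k.+1 * gamma k.+1.
Proof.
have -> : (1 + al * rho k) * gamma k - al * rho k.+1 * gamma k.+1 =
   (1 + al * rho k - al * rho k.+1 ^+ 2) * gamma k by rewrite gammaS; ring.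
by rewrite mulr_ge0 ?subr_ge0 ?rhoS_sqr//; exact/ltW/gamma_gt0.
Qed.

Lemma stepsize_dF k : gamma k.+1 * enorm (dF k) <= c * enorm (dx k).
Proof.
have [_ _ [_ _ h _]] := stepsize_facts k; rewrite /dF /dx.
(* At [k = 0] both differences vanish because [0.-1 = 0], while the estimate there is the free
   parameter [L0]. *)
case: k h => [_|k h] /=; first by rewrite !subrr !enorm0 !mulr0.
have [d0|d0] := eqVneq (enorm (x k.+1 - x k)) 0.
  rewrite d0 mulr0; have /eqP := enorm_eq0 d0; rewrite subr_eq0 => /eqP ->.
  by rewrite subrr enorm0 mulr0.
have := ler_wpM2r (enorm_ge0 (x k.+1 - x k)) h.
by rewrite -mulrA mulfVK.
Qed.

Lemma dF_dx_ge0 k : 0 <= inner (dF k) (dx k).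
Proof. exact: F_monotone. Qed.

Definition step_subgrad k :=
  (gamma k.+1)^-1 *: (x k - gamma k.+1 *: extrapolation F x al rho k - x k.+1).

Lemma iterate_subdifferential k : subdifferential g (x k.+1) (step_subgrad k).
Proof.
have [z /zer_subdifferential gz] := zer_nonempty.
rewrite /step_subgrad xE; exact: (prox_subdifferential g_proper g_convex g_lsc _ (gamma_gt0 _) gz).
Qed.

Lemma iterate_fin k : g (x k.+1) \is a fin_num.
Proof. exact: (subdifferential_fin g_proper (iterate_subdifferential k)). Qed.

(* The real-valued gap and Lyapunov function are meaningful only where [g] is finite at the
   iterate involved; this may fail at [x 0]. *)
Definition rgap k z := fine (g (x k)) - fine (g z) - inner (F (x k)) (z - x k).

Lemma proper_pinfty y : g y \isn't a fin_num -> g y = +oo%E.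
Proof. by case: g_proper => /(_ y) + _; case: (g y). Qed.

Lemma gap_pinfty k z : g (x k) \isn't a fin_num -> g z \is a fin_num -> gap F g x k z = +oo%E.
Proof. by move=> /proper_pinfty gx gz; rewrite /gap gx -(fineK gz). Qed.

Lemma gap_fine k z : g (x k) \is a fin_num -> g z \is a fin_num -> gap F g x k z = (rgap k z)%:E.
Proof.
by move=> gx gz; rewrite /gap -{1}(fineK gx) -{1}(fineK gz) -!EFinB.
Qed.

Let lam := cst_lambda al / 2.

(** The decrease [d] is uniform over all admissible ratios; Young's weights stay hidden. *)
Definition descent_coef d := forall r, 0 <= r -> r <= beta -> exists m e, [/\ 0 < m, 0 < e,
  (al * r) ^+ 2 * (1 + (2 - al) / (2 * al * e) + m^-1) <= lam &
  (1 - al) * r ^+ 2 - 2^-1 + al * (2 - al) * r ^+ 2 * e / 2 +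
    c ^+ 2 * ((1 + m) * (1 + al * r) ^+ 2 + lam * r ^+ 2) <= - d].

Lemma descent_coef_exists : exists2 d, 0 < d & descent_coef d.
Proof.
have [a1 a2] : 1 <= al /\ al <= 2 by [].
have [m [e [d [m0 e0 d0 hl hc]]]] := lyapunov_coef al1 al2 cE.
exists d => // r r0 rb; exists m, e; split => //; last exact: hc.
rewrite /lam hl ler_wpM2r//.
  have h1 : 0 <= m^-1 by rewrite invr_ge0 ltW.
  have h2 : 0 <= (2 - al) / (2 * al * e) by rewrite divr_ge0 ?mulr_ge0//; lra.
  by lra.
have b0 : 0 <= beta by exact: le_trans r0 rb.
by rewrite lerXn2r ?nnegrE ?mulr_ge0 ?ler_wpM2l//; lra.
Qed.

(** * Estimates relative to a fixed solution *)

Section solution.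
Variable z : 'rV[R]_n.
Hypothesis gz : subdifferential g z (- F z).

Let gz_fin : g z \is a fin_num. Proof. exact: (subdifferential_fin g_proper gz). Qed.

Lemma rgap_ge0 k : g (x k) \is a fin_num -> 0 <= rgap k z.
Proof.
move=> gk; have := subdifferential_ge g_proper gz gk.
have := F_monotone (x k) z; rewrite /rgap !innerE; lra.
Qed.

Lemma gap_ge0 k : (0 <= gap F g x k z)%E.
Proof.
have [gk|gk] := boolP (g (x k) \is a fin_num).
  by rewrite gap_fine// lee_fin rgap_ge0.
by rewrite gap_pinfty// leey.
Qed.

Definition rlyap k := 2^-1 * enorm (x k - z) ^+ 2 + 2^-1 * enorm (dx k) ^+ 2
  + lam * (gamma k * rho k) ^+ 2 * enorm (dF k.-1) ^+ 2
  + (1 + al * rho k) * gamma k * rgap k.-1 z.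

Lemma lyapunov_fine k : g (x k.-1) \is a fin_num ->
  lyapunov F g x al gamma rho k z = (rlyap k)%:E.
Proof.
move=> gk; rewrite /lyapunov gap_fine// -EFinM -EFinD; congr EFin.
by rewrite /rlyap /lam /dx /dF; ring.
Qed.

Lemma lyapunov_pinfty k : g (x k.-1) \isn't a fin_num ->
  lyapunov F g x al gamma rho k z = +oo%E.
Proof.
move=> gk; have w0 : 0 < (1 + al * rho k) * gamma k.
  have a1 := al1; have := gamma_gt0 k; have := rho_gt0 k => r0 g0.
  by rewrite mulr_gt0// addr_gt0// mulr_gt0//; lra.
by rewrite /lyapunov gap_pinfty// gt0_muley ?lte_fin// addey.
Qed.

Definition ediff k := (gamma k * rho k) *: dF k.-1.

(** Both surplus terms are kept: the weighted gap yields the summed gap estimate, the squared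
    increment yields [dx_cvg0]. *)
Lemma lyapunov_descent (coef : R) : descent_coef coef ->
  forall k, g (x k) \is a fin_num ->
  rlyap k.+2 + ((1 + al * rho k.+1) * gamma k.+1 - al * rho k.+2 * gamma k.+2) * rgap k z
    + coef * enorm (dx k.+1) ^+ 2 <= rlyap k.+1.
Proof.
move=> coefP k gk; have [m [e [m0 e0 hl hc]]] := coefP _ (ltW (rho_gt0 k.+2)) (rho_le_beta k.+2); rewrite -/lam in hl hc *.
have t0 := ltW (gamma_gt0 k.+2); have r0 := ltW (rho_gt0 k.+2).
have gk1 := iterate_fin k; have gk2 := iterate_fin k.+1.
have s1 := iterate_subdifferential k; have s2 := iterate_subdifferential k.+1.
pose a := dx k.+1; pose b := dx k.+2; pose p := x k.+1 - z; pose f := F (x k).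
pose D := dF k.+1; pose E := ediff k.+1.
pose t := gamma k.+2; pose r := rho k.+2.
have hD : t ^+ 2 * inner D D <= c ^+ 2 * inner a a.
  have c0 := ltW step_const_gt0.
  rewrite -!enorm_sqr -!exprMn lerXn2r ?nnegrE ?mulr_ge0 ?enorm_ge0//.
  exact: stepsize_dF.
have Da : 0 <= inner D a by exact: dF_dx_ge0.
have tg : t = r * gamma k.+1 by rewrite /t /r gammaS.
have e2 : t *: step_subgrad k.+1 = - (b + t *: (f + D) + (al * r * t) *: D).
  rewrite /step_subgrad scalerA divff ?gt_eqF ?gamma_gt0// scale1r /extrapolation.
  by apply/rowP => i; rewrite /b /D /f /t /r /dx /dF !mxE /=; ring.
(* Scaling this subgradient by [t] too, rather than by its own stepsize [gamma k.+1], lets the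
   values of [g] cancel and produces the factor [r]. *)
have e1 : t *: step_subgrad k = - (r *: a + t *: f + (al * r) *: E).
  rewrite /step_subgrad scalerA tg mulfK ?gt_eqF ?gamma_gt0//.
  by apply/rowP => i; rewrite /a /E /f /ediff /extrapolation /dx /dF !mxE /=; ring.
have xz : z - x k.+2 = - (p + b) by apply/rowP => i; rewrite /p /b /dx !mxE /=; ring.
have xk : x k.+1 - x k.+2 = - b by rewrite /b /dx /= opprB.
have xk1 : x k.+2 - x k.+1 = b by [].
have xk0 : x k - x k.+1 = - a by rewrite /a /dx /= opprB.
have I s j y : subdifferential g (x j) s -> g y \is a fin_num ->
    t * (fine (g (x j)) - fine (g y)) + inner (t *: s) (y - x j) <= 0.
  move=> sj gy; have := ler_wpM2l t0 (subdifferential_ge g_proper sj gy).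
  by rewrite innerZl mulrDr -/t; lra.
have := I _ _ _ s2 gz_fin; rewrite e2 xz innerNl innerNr opprK => I1.
have := I _ _ _ s2 gk1; rewrite e2 xk innerNl innerNr opprK => I2.
have := I _ _ _ s1 gk2; rewrite e1 xk1 innerNl => I3.
have := I _ _ _ s1 gk; rewrite e1 xk0 innerNl innerNr opprK => I4.
have := descent_abstract al1 al2 r0 t0 m0 e0 hl hc hD Da I1 I2 I3 I4.
have -> : p + b = x k.+2 - z by rewrite -[LHS]opprK -xz opprB.
have -> : f + D = F (x k.+1) by rewrite /f /D /dF /= addrC subrK.
have -> : a - p = z - x k by apply/rowP => i; rewrite /a /p /dx !mxE /=; ring.
have EE : inner E E = (gamma k.+1 * rho k.+1) ^+ 2 * inner (dF k) (dF k).
  by rewrite /E /ediff !innerE mulrA -expr2.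
rewrite EE /rlyap /rgap -!enorm_sqr -/t -/r -/a -/b -/D -/f /=.
have -> : z - x k.+1 = - p by rewrite /p opprB.
rewrite innerNr -/p -/(dx k.+2) -/b.
by move=> H; lra.
Qed.

Lemma cst_lambda_ge0 : 0 <= lam.
Proof.
have [a1 a2] : 1 <= al /\ al <= 2 by [].
have [m [e [d [m0 e0 d0 hl _]]]] := lyapunov_coef al1 al2 cE.
have h1 : 0 <= m^-1 by rewrite invr_ge0 ltW.
have h2 : 0 <= (2 - al) / (2 * al * e) by rewrite divr_ge0 ?mulr_ge0//; lra.
by rewrite /lam hl mulr_ge0 ?sqr_ge0//; lra.
Qed.

Lemma gap_coef_gt0 k : 0 < (1 + al * rho k) * gamma k.
Proof.
have a1 := al1; have g0 := gamma_gt0 k; have r0 := rho_gt0 k.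
by rewrite mulr_gt0// addr_gt0// mulr_gt0//; lra.
Qed.

Lemma rlyap_ge_gap k : (1 + al * rho k) * gamma k * rgap k.-1 z <= rlyap k.
Proof.
have h1 := sqr_ge0 (enorm (x k - z)); have h2 := sqr_ge0 (enorm (dx k)).
have h3 := mulr_ge0 (mulr_ge0 cst_lambda_ge0 (sqr_ge0 (gamma k * rho k))) (sqr_ge0 (enorm (dF k.-1))).
by rewrite /rlyap; lra.
Qed.

Lemma rlyap_ge_dist k : g (x k.-1) \is a fin_num -> 2^-1 * enorm (x k - z) ^+ 2 <= rlyap k.
Proof.
move=> gk; have h2 := sqr_ge0 (enorm (dx k)).
have h3 := mulr_ge0 (mulr_ge0 cst_lambda_ge0 (sqr_ge0 (gamma k * rho k))) (sqr_ge0 (enorm (dF k.-1))).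
have h4 := mulr_ge0 (ltW (gap_coef_gt0 k)) (rgap_ge0 gk).
by rewrite /rlyap; lra.
Qed.

Lemma rlyap_ge0 k : g (x k.-1) \is a fin_num -> 0 <= rlyap k.
Proof.
by move=> gk; apply: le_trans (rlyap_ge_dist gk); rewrite mulr_ge0 ?sqr_ge0.
Qed.

Lemma rlyap_step k : g (x k) \is a fin_num ->
  rlyap k.+2 + ((1 + al * rho k.+1) * gamma k.+1 - al * rho k.+2 * gamma k.+2) * rgap k z
  <= rlyap k.+1.
Proof.
move=> gk; have [d d0 dP] := descent_coef_exists.
apply: le_trans (lyapunov_descent dP gk).
by rewrite lerDl mulr_ge0 ?sqr_ge0// ltW.
Qed.

Lemma rlyap_le k : g (x k) \is a fin_num -> rlyap k.+2 <= rlyap k.+1.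
Proof.
move=> gk; apply: le_trans (rlyap_step gk).
by rewrite lerDl mulr_ge0 ?gap_weight_ge0 ?rgap_ge0.
Qed.

Lemma rlyap_nonincr i j : (i <= j)%N -> rlyap j.+2 <= rlyap i.+2.
Proof.
move=> /subnK <-; elim: (j - i)%N => // k IH.
by apply: le_trans IH; apply: rlyap_le; exact: iterate_fin.
Qed.

(** The weights [(1 + al * rho k) * gamma k - al * rho k.+1 * gamma k.+1] telescope to the sum of
    stepsizes plus boundary terms. The start [s] is free because [g (x 0)] may be infinite. *)
Lemma gap_sum_le s N v : g (x s) \is a fin_num -> 0 <= v ->
  (forall k, (s <= k <= s + N)%N -> v <= rgap k z) ->
  v * (\sum_(s.+1 <= k < (s + N).+2) gamma k) <= rlyap s.+1.
Proof.
move=> gs v0 vV.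
have gfin i : g (x (s + i)) \is a fin_num.
  by case: i => [|i]; rewrite ?addn0// addnS iterate_fin.
have tele i : (i <= N)%N -> rlyap (s + i).+1 + v * (\sum_(s.+1 <= k < (s + i).+1) gamma k
    + al * rho s.+1 * gamma s.+1 - al * rho (s + i).+1 * gamma (s + i).+1) <= rlyap s.+1.
  elim: i => [|i IH] iN; first by rewrite addn0 big_geq// add0r subrr mulr0 addr0.
  apply: le_trans (IH (ltnW iN)).
  rewrite addnS big_nat_recr/=; last by rewrite ltnS leq_addr.
  have := rlyap_step (gfin i).
  have vi : v <= rgap (s + i) z by apply: vV; rewrite leq_addr leq_add2l ltnW.
  have := ler_wpM2l (gap_weight_ge0 (s + i).+1) vi.
  by lra.
(* The gap inside the last Lyapunov value cancels the negative boundary term and supplies the final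
   stepsize. *)
have := tele N (leqnn N); have := rlyap_ge_gap (s + N).+1.
have vN : v <= rgap (s + N) z by apply: vV; rewrite leq_addr leqnn.
have := ler_wpM2l (ltW (gap_coef_gt0 (s + N).+1)) vN.
rewrite [in X in _ -> _ -> _ -> X]big_nat_recr/=; last by rewrite ltnS leq_addr.
have : 0 <= v * (al * rho s.+1 * gamma s.+1).
  have a1 := al1; rewrite !mulr_ge0 ?(ltW (rho_gt0 _)) ?(ltW (gamma_gt0 _))//; lra.
by lra.
Qed.

Lemma iterates_bounded : exists M, forall k, enorm (x k) <= M.
Proof.
pose C := Num.sqrt (2 * rlyap 2); have C0 : 0 <= C by exact: sqrtr_ge0.
have e0 := enorm_ge0 (x 0%N); have e1 := enorm_ge0 (x 1%N); have ez := enorm_ge0 z.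
exists (C + enorm z + enorm (x 0%N) + enorm (x 1%N)) => -[|[|k]]; try lra.
have h : enorm (x k.+2 - z) <= C.
  rewrite -[leLHS]ger0_norm ?enorm_ge0// -sqrtr_sqr ler_wsqrtr//.
  have := rlyap_ge_dist (iterate_fin k : g (x k.+2.-1) \is a fin_num).
  have := rlyap_nonincr (leq0n k); lra.
by have := enormD (x k.+2 - z) z; rewrite subrK; lra.
Qed.

(** * Vanishing increments, gaps and Lyapunov terms *)

Lemma dx_cvg0 : enorm (dx k) @[k --> \oo] --> (0 : R).
Proof.
have [d d0 dP] := descent_coef_exists.
pose u k := rlyap k.+2.
have cu : cvgn u.
  apply/cvg_ex; eexists; apply: nonincreasing_cvgn => [i j ij|]; first exact: rlyap_nonincr.
  exists 0 => _ [k _ <-]; exact: (@rlyap_ge0 k.+2 (iterate_fin k)).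
have cu1 : u k.+1 @[k --> \oo] --> limn u by rewrite (cvg_shiftS u).
have cd : d^-1 * (u k - u k.+1) @[k --> \oo] --> (0 : R).
  have -> : 0 = d^-1 * (limn u - limn u) by rewrite subrr mulr0.
  exact: (cvgM (cvg_cst _) (cvgB cu cu1)).
have nd : \forall k \near \oo, 0 <= enorm (dx k.+2) ^+ 2 <= d^-1 * (u k - u k.+1).
  near=> k; rewrite sqr_ge0 /= ler_pdivlMl//.
  have := lyapunov_descent dP (iterate_fin k).
  have := mulr_ge0 (gap_weight_ge0 k.+2) (rgap_ge0 (iterate_fin k)).
  by rewrite /u; lra.
have c2 : enorm (dx k.+2) ^+ 2 @[k --> \oo] --> (0 : R).
  exact: (squeeze_cvgr nd (cvg_cst (0 : R)) cd).
have e : (fun k => enorm (dx k.+2)) = Num.sqrt \o (fun k => enorm (dx k.+2) ^+ 2).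
  by apply: funext => k /=; rewrite sqrtr_sqr ger0_norm ?enorm_ge0.
have cs : Num.sqrt (enorm (dx k.+2) ^+ 2) @[k --> \oo] --> Num.sqrt (0 : R).
  apply: cvg_comp c2 _; exact: sqrt_continuous.
rewrite -(cvg_shiftS (fun k => enorm (dx k))) -(cvg_shiftS (fun k => enorm (dx k.+1))) e.
by rewrite sqrtr0 in cs.
Unshelve. all: by end_near. Qed.

Let delta k := enorm (dx k.+2) + enorm (dx k.+1) + enorm (dx k).

Lemma delta_cvg0 : delta k @[k --> \oo] --> (0 : R).
Proof.
have c0 := dx_cvg0.
have c1 : enorm (dx k.+1) @[k --> \oo] --> (0 : R) by rewrite (cvg_shiftS (fun k => enorm (dx k))).
have c2 : enorm (dx k.+2) @[k --> \oo] --> (0 : R).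
  by rewrite (cvg_shiftS (fun k => enorm (dx k.+1))).
have -> : (0 : R) = 0 + 0 + 0 by rewrite !addr0.
exact: (cvgD (cvgD c2 c1) c0).
Qed.

Lemma beta_ge1 : 1 <= beta.
Proof. by have [] := cst_beta_spec al1 al2. Qed.

Let C1 := c + beta + al * beta * beta * c.

Lemma C1_ge0 : 0 <= C1.
Proof.
have c0 := step_const_gt0; have b1 := beta_ge1; have a1 := al1.
have := mulr_ge0 (mulr_ge0 (mulr_ge0 (_ : 0 <= al) (_ : 0 <= beta)) (_ : 0 <= beta)) (_ : 0 <= c).
by rewrite /C1 => H; have := H; lra.
Qed.

(** Once [F (x k.+1)] is split off the subgradient at [x k.+1], the rest consists of increments
    only; testing at [z] gives the gap. The three terms of [C1] bound [t *: D], [r *: a] and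
    [(al * r) *: E]. *)
Lemma weighted_gap_le k : gamma k.+2 * rgap k.+1 z <= C1 * delta k * enorm (x k.+1 - z).
Proof.
have a1 := al1; have c0 := step_const_gt0; have b1 := beta_ge1.
pose a := dx k.+1; pose p := x k.+1 - z; pose D := dF k.+1; pose E := ediff k.+1.
pose t := gamma k.+2; pose r := rho k.+2.
have t0 : 0 <= t := ltW (gamma_gt0 k.+2); have r0 : 0 <= r := ltW (rho_gt0 k.+2).
have rb : r <= beta := rho_le_beta k.+2.
have tg : t = r * gamma k.+1 by rewrite /t /r gammaS.
have e1 : t *: step_subgrad k = t *: D - r *: a - (al * r) *: E - t *: F (x k.+1).
  rewrite /step_subgrad scalerA {1}tg mulfK ?gt_eqF ?gamma_gt0//.
  by apply/rowP => i; rewrite tg /a /E /D /ediff /extrapolation /dx /dF !mxE /=; ring.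
have s1 := ler_wpM2l t0 (subdifferential_ge g_proper (iterate_subdifferential k) gz_fin).
have h : t * rgap k.+1 z <= inner (t *: D - r *: a - (al * r) *: E) p.
  have : t * inner (step_subgrad k) (z - x k.+1) =
    - inner (t *: D - r *: a - (al * r) *: E) p - t * inner (F (x k.+1)) (z - x k.+1).
    by rewrite -innerZl e1 innerBl innerZl -[z - x k.+1]opprB -/p !innerNr.
  by move: s1; rewrite /rgap; lra.
apply: le_trans h (le_trans (inner_le _ _) _).
rewrite ler_wpM2r ?enorm_ge0//.
have n1 : enorm (t *: D) <= c * enorm a by rewrite enormZ ger0_norm// stepsize_dF.
have n2 : enorm (r *: a) <= beta * enorm a.
  by rewrite enormZ ger0_norm// ler_wpM2r ?enorm_ge0.
have n3 : enorm ((al * r) *: E) <= al * beta * beta * c * enorm (dx k).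
  have ar0 : 0 <= al * r by rewrite mulr_ge0//; lra.
  have g1 := ltW (gamma_gt0 k.+1); have r1 := ltW (rho_gt0 k.+1).
  rewrite enormZ ger0_norm// /E /ediff enormZ ger0_norm ?mulr_ge0//=.
  have q1 : gamma k.+1 * rho k.+1 * enorm (dF k) <= beta * (c * enorm (dx k)).
    rewrite mulrAC mulrC; apply: ler_pM; rewrite ?mulr_ge0 ?enorm_ge0 ?rho_le_beta//.
    exact: stepsize_dF.
  have q2 : al * r <= al * beta by rewrite ler_wpM2l//; lra.
  apply: le_trans (ler_pM ar0 _ q2 q1) _; first by rewrite !mulr_ge0 ?enorm_ge0.
  by rewrite !mulrA.
apply: le_trans (enormD _ _) _; rewrite enormN.
apply: le_trans (lerD (enormD _ _) n3) _; rewrite enormN.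
have d0 := enorm_ge0 (dx k); have d2 := enorm_ge0 (dx k.+2); have d1 := enorm_ge0 a.
have k1 : (c + beta) * enorm a <= (c + beta) * delta k by rewrite ler_wpM2l /delta -/a; lra.
have k2 : al * beta * beta * c * enorm (dx k) <= al * beta * beta * c * delta k.
  rewrite ler_wpM2l//; last by rewrite /delta -/a; lra.
  by rewrite !mulr_ge0//; lra.
by rewrite /C1; lra.
Qed.

Lemma weighted_gap_cvg0 : gamma k.+2 * rgap k.+1 z @[k --> \oo] --> (0 : R).
Proof.
have [M xM] := iterates_bounded.
have cd : C1 * delta k * (M + enorm z) @[k --> \oo] --> (0 : R).
  have -> : 0 = C1 * 0 * (M + enorm z) by rewrite mulr0 mul0r.
  exact: (cvgM (cvgM (cvg_cst _) delta_cvg0) (cvg_cst _)).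
have nd : \forall k \near \oo, 0 <= gamma k.+2 * rgap k.+1 z <= C1 * delta k * (M + enorm z).
  near=> k; apply/andP; split.
    by rewrite mulr_ge0 ?(ltW (gamma_gt0 _))// rgap_ge0// iterate_fin.
  apply: le_trans (weighted_gap_le k) _.
  rewrite ler_wpM2l ?mulr_ge0 ?C1_ge0 ?addr_ge0 ?enorm_ge0//.
  by apply: le_trans (enormD _ _) _; rewrite enormN lerD2r.
exact: (squeeze_cvgr nd (cvg_cst (0 : R)) cd).
Unshelve. all: by end_near. Qed.

Lemma lyapunov_excess_cvg0 :
  rlyap k.+2 - 2^-1 * enorm (x k.+2 - z) ^+ 2 @[k --> \oo] --> (0 : R).
Proof.
have a1 := al1; have b1 := beta_ge1.
have cd2 : (2^-1 + lam * (beta * c) ^+ 2) * delta k ^+ 2 +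
    (1 + al * beta) * (gamma k.+2 * rgap k.+1 z) @[k --> \oo] --> (0 : R).
  have -> : 0 = (2^-1 + lam * (beta * c) ^+ 2) * (0 * 0) + (1 + al * beta) * 0.
    by rewrite !mulr0 addr0.
  exact: (cvgD (cvgM (cvg_cst _) (cvgM delta_cvg0 delta_cvg0)) (cvgM (cvg_cst _) weighted_gap_cvg0)).
have nd : \forall k \near \oo, 0 <= rlyap k.+2 - 2^-1 * enorm (x k.+2 - z) ^+ 2 <=
    (2^-1 + lam * (beta * c) ^+ 2) * delta k ^+ 2 + (1 + al * beta) * (gamma k.+2 * rgap k.+1 z).
  near=> k; rewrite subr_ge0 (rlyap_ge_dist (iterate_fin k : g (x k.+2.-1) \is a fin_num)) /=.
  have d0 := enorm_ge0 (dx k); have d1 := enorm_ge0 (dx k.+1); have d2 := enorm_ge0 (dx k.+2).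
  have h1 : enorm (dx k.+2) ^+ 2 <= delta k ^+ 2.
    by rewrite lerXn2r ?nnegrE ?addr_ge0// /delta; lra.
  have h2 : (gamma k.+2 * rho k.+2) ^+ 2 * enorm (dF k.+1) ^+ 2 <= (beta * c) ^+ 2 * delta k ^+ 2.
    rewrite -!exprMn; have c0 := ltW step_const_gt0.
    have g1 := ltW (gamma_gt0 k.+2); have r1 := ltW (rho_gt0 k.+2).
    have b0 : 0 <= beta by lra.
    rewrite lerXn2r ?nnegrE ?mulr_ge0 ?enorm_ge0// ?addr_ge0//.
    rewrite mulrAC [leLHS]mulrC -mulrA; apply: ler_pM; rewrite ?mulr_ge0 ?enorm_ge0 ?rho_le_beta//.
    apply: le_trans (stepsize_dF _) _; rewrite ler_wpM2l// /delta; lra.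
  have h3 := ler_wpM2l cst_lambda_ge0 h2.
  have g0 : 0 <= gamma k.+2 * rgap k.+1 z.
    by rewrite mulr_ge0 ?(ltW (gamma_gt0 _))// rgap_ge0// iterate_fin.
  have h4 : (1 + al * rho k.+2) * (gamma k.+2 * rgap k.+1 z) <= (1 + al * beta) * (gamma k.+2 * rgap k.+1 z).
    by rewrite ler_wpM2r// lerD2l ler_wpM2l ?rho_le_beta//; lra.
  by rewrite /rlyap /=; lra.
exact: (squeeze_cvgr nd (cvg_cst (0 : R)) cd2).
Unshelve. all: by end_near. Qed.

End solution.

(** * Stepsize bounds and convergence of the iterates *)

Lemma lip_estimate_le A L : hull_modulus F x A L ->
  forall k, (0 < k)%N -> lip_estimate F x L0 k <= L.
Proof.
move=> [_ _ xA [L_ge0 FL]] [//|k] _ /=.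
have [->|d0] := eqVneq (enorm (x k.+1 - x k)) 0; first by rewrite invr0 mulr0.
rewrite ler_pdivrMr; first exact: FL.
by rewrite lt_neqAle eq_sym d0 enorm_ge0.
Qed.

Lemma stepsize_cases k : [\/ gamma k.+1 = gamma k * Num.sqrt (al^-1 + rho k),
      gamma k.+1 = (2 / 3 + 2 * al / 5) * gamma k
    | gamma k.+1 * lip_estimate F x L0 k = c].
Proof. by have [_ _ []] := stepsize_facts k. Qed.

Lemma hull_exists : exists A L, hull_modulus F x A L /\ Num.sqrt al * L0 <= L.
Proof.
have [z /zer_subdifferential gz] := zer_nonempty.
have [M xM] := iterates_bounded gz.
exact: hull_modulus_exists.
Qed.

Lemma sqrt_al_ge1 : 1 <= Num.sqrt al.
Proof. by rewrite -[leLHS]sqrtr1 ler_wsqrtr. Qed.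

Lemma hull_ge_L0 L : Num.sqrt al * L0 <= L -> L0 <= L.
Proof. by apply: le_trans; rewrite ler_peMl ?sqrt_al_ge1 ?ltW. Qed.

Lemma gamma_lower_bound : exists2 s, 0 < s & forall k, s <= gamma k.
Proof.
have [A [L [AL L0L]]] := hull_exists.
have L_ge0 : 0 <= L by case: AL => _ _ _ [].
have Lpos : 0 < L by apply: lt_le_trans (hull_ge_L0 L0L).
have sL : 0 < Num.sqrt al * L by rewrite mulr_gt0// (lt_le_trans ltr01 sqrt_al_ge1).
exists (Num.min (gamma 0%N) (c / (Num.sqrt al * L))).
  by rewrite lt_min gamma_gt0 divr_gt0 ?step_const_gt0.
move=> k; rewrite ge_min ler_pdivrMr//.
apply/orP.
exact: (stepsize_ge al1 al2 step_const_gt0 L_ge0 gamma_gt0 rhoE rho_init stepsize_cases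
  L0_gt0 (lip_estimate_le AL) (or_intror (hull_ge_L0 L0L))).
Qed.

Lemma cvg_along (T : topologicalType) (u : nat -> T) (l : T) (phi : nat -> nat) :
  (forall j, (j <= phi j)%N) -> u k @[k --> \oo] --> l -> u (phi j) @[j --> \oo] --> l.
Proof.
move=> phi_ge ul V /ul [N _ hN]; exists N => // j Nj.
exact: hN (leq_trans Nj (phi_ge j)).
Qed.

Lemma cvg_next (phi : nat -> nat) (p : 'rV[R]_n) :
  (forall j, (j <= phi j)%N) -> x (phi j) @[j --> \oo] --> p ->
  x (phi j).+1 @[j --> \oo] --> p.
Proof.
move=> phi_ge xp; have [z /zer_subdifferential gz] := zer_nonempty.
have d1 : enorm (dx k.+1) @[k --> \oo] --> (0 : R).
  by rewrite (cvg_shiftS (fun k => enorm (dx k))); exact: dx_cvg0 gz.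
have d2 : enorm (dx (phi j).+1) @[j --> \oo] --> (0 : R) by exact: (cvg_along phi_ge d1).
have v1 : dx (phi j).+1 @[j --> \oo] --> (0 : 'rV[R]_n) by exact: cvg_enorm0 d2.
have h : x (phi j) + dx (phi j).+1 @[j --> \oo] --> p + 0 by exact: (cvgD xp v1).
rewrite addr0 in h.
have -> : (fun j => x (phi j).+1) = (fun j => x (phi j) + dx (phi j).+1).
  by apply: funext => j; rewrite /dx /= addrC subrK.
exact: h.
Qed.

Lemma cluster_point_solution (phi : nat -> nat) (p : 'rV[R]_n) :
  (forall j, (j <= phi j)%N) -> x (phi j) @[j --> \oo] --> p -> subdifferential g p (- F p).
Proof.
move=> phi_ge xp.
have [z /zer_subdifferential gz] := zer_nonempty.
have [s s0 gs] := gamma_lower_bound.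
have [A [L [[_ _ xA [L_ge0 FL]] _]]] := hull_exists.
have b0 : 0 <= al * beta by have a1 := al1; have b1 := beta_ge1; rewrite mulr_ge0//; lra.
have d0 : enorm (dx (phi j)) @[j --> \oo] --> (0 : R).
  exact: (cvg_along phi_ge (dx_cvg0 gz)).
have d1 : enorm (dx (phi j).+1) @[j --> \oo] --> (0 : R).
  have h : enorm (dx k.+1) @[k --> \oo] --> (0 : R).
    by rewrite (cvg_shiftS (fun k => enorm (dx k))); exact: dx_cvg0 gz.
  exact: (cvg_along phi_ge h).
have xp1 := cvg_next phi_ge xp.
have Fp : F (x (phi j)) @[j --> \oo] --> F p.
  by apply: (cvg_comp _ _ xp); exact: locally_lipschitz_continuous.
(* The residual [- F (x_k) - step_subgrad k] along [phi]; it vanishes because stepsizes are bounded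
   below, ratios above, and increments tend to 0. *)
pose w j := (gamma (phi j).+1)^-1 *: dx (phi j).+1 + (al * rho (phi j).+1) *: dF (phi j).
have w0 : w j @[j --> \oo] --> (0 : 'rV[R]_n).
  apply: cvg_enorm0.
  have cb : s^-1 * enorm (dx (phi j).+1) + al * beta * L * enorm (dx (phi j)) @[j --> \oo] --> (0 : R).
    have -> : (0 : R) = s^-1 * 0 + al * beta * L * 0 by rewrite !mulr0 addr0.
    exact: (cvgD (cvgM (cvg_cst _) d1) (cvgM (cvg_cst _) d0)).
  have nb : \forall j \near \oo, 0 <= enorm (w j) <=
      s^-1 * enorm (dx (phi j).+1) + al * beta * L * enorm (dx (phi j)).
    near=> j; rewrite enorm_ge0 /=; apply: le_trans (enormD _ _) _; rewrite !enormZ.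
    have g0 := gamma_gt0 (phi j).+1; have r0 := ltW (rho_gt0 (phi j).+1).
    have a0 : 0 <= al by have a1 := al1; lra.
    rewrite !ger0_norm ?invr_ge0 ?(ltW g0) ?mulr_ge0//.
    apply: lerD.
      by rewrite ler_wpM2r ?enorm_ge0// lef_pV2 ?posrE.
    rewrite -[leRHS]mulrA; apply: ler_pM; rewrite ?enorm_ge0 ?mulr_ge0//.
      by rewrite ler_wpM2l ?rho_le_beta.
    exact: FL.
  exact: (squeeze_cvgr nb (cvg_cst (0 : R)) cb).
have sp : step_subgrad (phi j) @[j --> \oo] --> - F p.
  have h : - F (x (phi j)) - w j @[j --> \oo] --> - F p - 0 by exact: (cvgB (cvgN Fp) w0).
  rewrite subr0 in h.
  have -> : (fun j => step_subgrad (phi j)) = (fun j => - F (x (phi j)) - w j).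
    apply: funext => j; rewrite /step_subgrad /w /extrapolation.
    have g0 : gamma (phi j).+1 != 0 by rewrite gt_eqF// gamma_gt0.
    by apply/rowP => i; rewrite /dx /dF !mxE /=; field.
  exact: h.
exact: (subdifferential_closed g_proper g_lsc (fun j => iterate_subdifferential (phi j)) xp1 sp).
Unshelve. all: by end_near. Qed.

Lemma iterates_converge : exists p : 'rV[R]_n, [/\ zer (sum_op F g) p,
  x k @[k --> \oo] --> p & lyapunov F g x al gamma rho k p @[k --> \oo] --> 0%E].
Proof.
have [z /zer_subdifferential gz] := zer_nonempty.
have [M xM] := iterates_bounded gz.
have [p [phi [phi_ge xp]]] := bounded_subseq xM.
have gp := cluster_point_solution phi_ge xp.
have lyap0 : rlyap p k.+2 @[k --> \oo] --> (0 : R).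
  have x1 := cvg_next phi_ge xp.
  have x2 : x (phi j).+2 @[j --> \oo] --> p.
    by apply: (@cvg_next (fun j => (phi j).+1)) => // j; apply: leq_trans (phi_ge j) _.
  have n2 : enorm (x (phi j).+2 - p) @[j --> \oo] --> (0 : R) by exact: (cvg_enorm_subr x2).
  have e2 : rlyap p (phi j).+2 - 2^-1 * enorm (x (phi j).+2 - p) ^+ 2 @[j --> \oo] --> (0 : R).
    exact: (cvg_along phi_ge (lyapunov_excess_cvg0 gp)).
  have h : rlyap p (phi j).+2 - 2^-1 * enorm (x (phi j).+2 - p) ^+ 2
      + 2^-1 * (enorm (x (phi j).+2 - p) * enorm (x (phi j).+2 - p)) @[j --> \oo] --> (0 : R).
    have -> : (0 : R) = 0 + 2^-1 * (0 * 0) by rewrite !mulr0 addr0.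
    exact: (cvgD e2 (cvgM (cvg_cst _) (cvgM n2 n2))).
  apply/cvgrPdist_lt => e e0.
  (* One index with a small Lyapunov value suffices, by monotonicity. *)
  have [j hj] := @filter_ex _ _ _ _ (cvgr_lt _ h _ e0).
  rewrite -expr2 subrK in hj.
  exists (phi j) => // k /= jk; rewrite sub0r normrN ger0_norm.
    exact: le_lt_trans (rlyap_nonincr gp jk) hj.
  exact: (@rlyap_ge0 _ gp k.+2 (iterate_fin k)).
exists p; split; first exact/zer_subdifferential.
  have h : enorm (x k.+2 - p) @[k --> \oo] --> (0 : R).
    have sq : Num.sqrt (2 * rlyap p k.+2) @[k --> \oo] --> Num.sqrt (2 * 0 : R).
      have h2 : 2 * rlyap p k.+2 @[k --> \oo] --> (2 * 0 : R) by exact: (cvgM (cvg_cst _) lyap0).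
      apply: cvg_comp h2 _; exact: sqrt_continuous.
    rewrite mulr0 sqrtr0 in sq.
    have nb : \forall k \near \oo, 0 <= enorm (x k.+2 - p) <= Num.sqrt (2 * rlyap p k.+2).
      near=> k; rewrite enorm_ge0 /= -[leLHS]ger0_norm ?enorm_ge0// -sqrtr_sqr ler_wsqrtr//.
      have := @rlyap_ge_dist _ gp k.+2 (iterate_fin k); lra.
    exact: (squeeze_cvgr nb (cvg_cst (0 : R)) sq).
  apply: cvg_subr_enorm.
  by rewrite -(cvg_shiftS (fun k => enorm (x k - p))) -(cvg_shiftS (fun k => enorm (x k.+1 - p))).
pose l k := lyapunov F g x al gamma rho k p.
rewrite -(cvg_shiftS l) -(cvg_shiftS (fun k => l k.+1)).
have -> : (fun k => l k.+2) = EFin \o (fun k => rlyap p k.+2).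
  by apply: funext => k; exact: (@lyapunov_fine _ gp k.+2 (iterate_fin k)).
by apply: cvg_EFin => //; near=> k.
Unshelve. all: by end_near. Qed.

Lemma gap_cvg0 z : subdifferential g z (- F z) -> gap F g x k z @[k --> \oo] --> 0%E.
Proof.
move=> gz; have gz_fin := subdifferential_fin g_proper gz.
rewrite -(cvg_shiftS (fun k => gap F g x k z)).
have -> : (fun k => gap F g x k.+1 z) = EFin \o (fun k => rgap k.+1 z).
  by apply: funext => k; exact: (gap_fine (iterate_fin k) gz_fin).
have [s s0 gs] := gamma_lower_bound.
have cs : s^-1 * (gamma k.+2 * rgap k.+1 z) @[k --> \oo] --> (0 : R).
  have -> : (0 : R) = s^-1 * 0 by rewrite mulr0.
  exact: (cvgM (cvg_cst _) (weighted_gap_cvg0 gz)).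
have nb : \forall k \near \oo, 0 <= rgap k.+1 z <= s^-1 * (gamma k.+2 * rgap k.+1 z).
  near=> k; have v0 := rgap_ge0 gz (iterate_fin k).
  by rewrite v0 /= ler_pdivlMl// ler_wpM2r.
have cr : rgap k.+1 z @[k --> \oo] --> (0 : R).
  exact: (squeeze_cvgr nb (cvg_cst (0 : R)) cs).
by apply: cvg_EFin => //; near=> k.
Unshelve. all: by end_near. Qed.

Lemma stepsize_magnitude A L : hull_modulus F x A L ->
  gamma 0%N * L0 <= c \/ L0 <= L ->
  forall k, (Order.min (gamma 0%N)%:E (c%:E / (Num.sqrt al * L)%:E) <= (gamma k)%:E)%E.
Proof.
move=> AL init k; have L_ge0 : 0 <= L by case: AL => _ _ _ [].
have c0 := step_const_gt0; have g0 := gamma_gt0 k; rewrite ge_min.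
have [h|h] := stepsize_ge al1 al2 c0 L_ge0 gamma_gt0 rhoE rho_init stepsize_cases
  L0_gt0 (lip_estimate_le AL) init k; apply/orP; [by left; rewrite lee_fin|right].
have sL : 0 < Num.sqrt al * L.
  by rewrite -(pmulr_rgt0 _ g0); exact: lt_le_trans h.
by rewrite inver gt_eqF// -EFinM lee_fin ler_pdivrMr.
Qed.

Lemma stepsize_average_magnitude A L : hull_modulus F x A L ->
  gamma 0%N * L0 <= c \/ Num.sqrt al * L0 <= L ->
  forall K : nat, (1 <= K)%N ->
  (Order.min (gamma 0%N)%:E (c%:E / L%:E) <=
   (K%:R^-1 * \sum_(1 <= k < K.+1) gamma k)%R%:E)%E.
Proof.
move=> AL init K K1; have L_ge0 : 0 <= L by case: AL => _ _ _ [].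
have c0 := step_const_gt0; have g0 := gamma_gt0 0.
have [m [mE m0 mg mL]] : exists m, [/\ Order.min (gamma 0%N)%:E (c%:E / L%:E)%E = m%:E,
    0 <= m, m <= gamma 0%N & m * L <= c].
  have [L0'|L0'] := eqVneq L 0.
    exists (gamma 0%N); rewrite L0' inve0 gt0_muley ?lte_fin// min_l ?leey//.
    by split => //; [exact: ltW|rewrite mulr0 ltW].
  have Lp : 0 < L by rewrite lt_neqAle eq_sym L0' L_ge0.
  exists (Num.min (gamma 0%N) (c / L)); rewrite inver gt_eqF// -EFinM -EFin_min; split => //.
  - by rewrite le_min (ltW g0) ltW// divr_gt0.
  - by rewrite ge_min lexx.
  - by rewrite -ler_pdivlMr// ge_min lexx orbT.
rewrite mE lee_fin ler_pdivlMl ?ltr0n//.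
exact: (stepsize_average al1 al2 c0 L_ge0 gamma_gt0 rhoE rho_init stepsize_cases
  L0_gt0 (lip_estimate_le AL) m0 mg mL init).
Qed.

Lemma lyapunov_ge0 z k : zer (sum_op F g) z -> (0 <= lyapunov F g x al gamma rho k.+1 z)%E.
Proof.
move=> /zer_subdifferential gz; have [gk|gk] := boolP (g (x k) \is a fin_num).
  by rewrite lyapunov_fine// lee_fin rlyap_ge0.
by rewrite lyapunov_pinfty// leey.
Qed.

Lemma lyapunov_le z k : zer (sum_op F g) z ->
  (lyapunov F g x al gamma rho k.+2 z <= lyapunov F g x al gamma rho k.+1 z)%E.
Proof.
move=> /zer_subdifferential gz; have [gk|gk] := boolP (g (x k) \is a fin_num).
  by rewrite !lyapunov_fine ?iterate_fin// lee_fin rlyap_le.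
by rewrite [leRHS]lyapunov_pinfty// leey.
Qed.

Section gap_min.
Variable z : 'rV[R]_n.
Hypothesis gz : subdifferential g z (- F z).

Let gz_fin : g z \is a fin_num. Proof. exact: (subdifferential_fin g_proper gz). Qed.

Let gmin K : \bar R := \big[Order.min/+oo%E]_(k < K.+1) gap F g x k z.

Let gmin_ge0 K : (0 <= gmin K)%E.
Proof. by apply: le_bigmin => [|k _]; rewrite ?leey ?gap_ge0. Qed.

Let gmin_le K k : (k <= K)%N -> (gmin K <= gap F g x k z)%E.
Proof. by move=> kK; exact: (bigmin_le _ (Ordinal (kK : (k < K.+1)%N)) (fun i : 'I_K.+1 => gap F g x i z)). Qed.

Let gmin_sum s K : (s <= K)%N -> g (x s) \is a fin_num ->
  exists v, [/\ gmin K = v%:E, 0 <= v &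
    v * (\sum_(s.+1 <= k < K.+2) gamma k) <= rlyap z s.+1].
Proof.
move=> sK gs.
have gfin i : g (x (s + i)) \is a fin_num.
  by case: i => [|i]; rewrite ?addn0// addnS iterate_fin.
have [v vE] : exists v, gmin K = v%:E.
  have := gmin_ge0 K; have := gmin_le sK; rewrite gap_fine//.
  by case: (gmin K) => // v _ _; exists v.
have v0 : 0 <= v by have := gmin_ge0 K; rewrite vE lee_fin.
exists v; split => //.
rewrite -(subnKC sK); apply: (gap_sum_le gz gs v0) => k /andP[sk kK].
have gk : g (x k) \is a fin_num by rewrite -(subnKC sk).
by rewrite -lee_fin -vE -(gap_fine gk gz_fin) gmin_le// -(subnKC sK).
Qed.

Lemma gap_min_le K : (gmin K <= lyapunov F g x al gamma rho 1 z /
  (\sum_(1 <= k < K.+2) gamma k)%R%:E)%E.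
Proof.
have sum_gt0 : 0 < \sum_(1 <= k < K.+2) gamma k.
  rewrite big_nat_recl//= ltr_pwDl ?gamma_gt0//.
  by apply: sumr_ge0 => k _; rewrite ltW ?gamma_gt0.
have [g0|g0] := boolP (g (x 0%N) \is a fin_num); last first.
  by rewrite lyapunov_pinfty// inver gt_eqF// gt0_mulye ?leey// lte_fin invr_gt0.
have [v [-> v0 h]] := gmin_sum (leq0n K) g0.
by rewrite lyapunov_fine// inver gt_eqF// -EFinM lee_fin ler_pdivlMr.
Qed.

(** Summing from index 1 gives the real constant [rlyap z 2], even when [U_1] is infinite; [1 <= K]
    puts the finite gap at [x 1] under the minimum. *)
Lemma gap_min_rate : exists C : R, forall K : nat, (1 <= K)%N ->
  (`| gmin K | <= (C / K%:R)%:E)%E.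
Proof.
have [s s0 gs] := gamma_lower_bound.
exists (rlyap z 2 / s) => K K1.
have [v [vE v0 h]] := gmin_sum K1 (iterate_fin 0).
rewrite gee0_abs ?gmin_ge0// vE lee_fin -mulrA -invfM ler_pdivlMr ?mulr_gt0 ?ltr0n//.
apply: le_trans h; rewrite ler_wpM2l//.
have -> : s * K%:R = \sum_(2 <= k < K.+2) s by rewrite sumr_const_nat subSS subn1 mulr_natr.
by apply: ler_sum.
Qed.

End gap_min.

End iterates.

Unset Implicit Arguments.

(** Comparing [U 1] with [U 0] would require a subgradient at [x 0], so the descent starts at
    [k = 1]. The alternatives on [L0] say that the first step is not shortened below [gamma0] by
    [L0], or that [L] dominates [L0], with an extra [sqrt alpha] for the average; the existence
    clause shows that such moduli exist. *)
Theorem theorem2p4 (R : realType) (n : nat)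
  (F : 'rV[R]_n -> 'rV[R]_n) (g : 'rV[R]_n -> \bar R)
  (F_monotone : monotone_op F) (F_lipschitz : locally_lipschitz F)
  (g_proper : proper_fun g) (g_convex : convex_fun g)
  (g_lsc : lower_semicontinuous g)
  (zer_nonempty : zer (sum_op F g) !=set0)
  (alpha c gamma0 L0 : R)
  (alpha_ge1 : 1 <= alpha) (alpha_le2 : alpha <= 2)
  (cE : c = (7 - alpha)^-1) (gamma0_gt0 : 0 < gamma0) (L0_gt0 : 0 < L0)
  (x : nat -> 'rV[R]_n) (gamma rho : nat -> R)
  (gamma_init : gamma 0%N = gamma0) (rho_init : rho 0%N = 1)
  (gammaE : forall k,
     (gamma k.+1)%:E = next_stepsize F x alpha c L0 gamma rho k)
  (rhoE : forall k, rho k.+1 = gamma k.+1 / gamma k)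
  (xE : forall k,
     x k.+1 = prox (gamma k.+1) g
                (x k - gamma k.+1 *: extrapolation F x alpha rho k)) :
  let U := lyapunov F g x alpha gamma rho in
  let V := gap F g x in
  forall xs, zer (sum_op F g) xs ->
  [/\ (* Lyapunov descent *)
      [/\ forall k, (0 <= U k.+1 xs)%E,
          forall k, (1 <= k)%N -> (U k.+1 xs <= U k xs)%E
        & exists M : R, forall k, enorm (x k) <= M],
      (* stepsize magnitude *)
      (exists (A : set 'rV[R]_n) (L : R),
         hull_modulus F x A L /\ Num.sqrt alpha * L0 <= L) /\
      (forall (A : set 'rV[R]_n) (L : R), hull_modulus F x A L ->
         gamma0 * L0 <= c \/ L0 <= L ->
         forall k, (Order.min gamma0%:E (c%:E / (Num.sqrt alpha * L)%:E)
                    <= (gamma k)%:E)%E),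
      (* Stampacchia gap *)
      (forall K : nat,
         (\big[Order.min/+oo]_(k < K.+1) V k xs
          <= U 1%N xs / (\sum_(1 <= k < K.+2) gamma k)%R%:E)%E) /\
      (exists C : R, forall K : nat, (1 <= K)%N ->
         (`| \big[Order.min/+oo]_(k < K.+1) V k xs | <= (C / K%:R)%:E)%E),
      (* average stepsize magnitude *)
      forall (A : set 'rV[R]_n) (L : R), hull_modulus F x A L ->
        gamma0 * L0 <= c \/ Num.sqrt alpha * L0 <= L ->
        forall K : nat, (1 <= K)%N ->
          (Order.min gamma0%:E (c%:E / L%:E)
           <= (K%:R^-1 * \sum_(1 <= k < K.+1) gamma k)%R%:E)%E
    & (* sequence convergence *)
      (exists xinf, [/\ zer (sum_op F g) xinf, x k @[k --> \oo] --> xinf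
                      & U k xinf @[k --> \oo] --> 0%E]) /\
      (forall z, zer (sum_op F g) z -> V k z @[k --> \oo] --> 0%E)].

Proof.
move=> U V xs zxs.
have gxs := (zer_subdifferential F g xs).1 zxs.
have g0 : 0 < gamma 0%N by rewrite gamma_init.
rewrite -gamma_init.
split.
- split.
  + move=> k; exact: (lyapunov_ge0 F_monotone g_proper
      alpha_ge1 alpha_le2 cE L0_gt0 g0 rho_init gammaE rhoE k zxs).
  + move=> [//|k] _; exact: (lyapunov_le F_monotone g_proper g_convex g_lsc alpha_ge1 alpha_le2 cE L0_gt0
    g0 rho_init gammaE rhoE xE zer_nonempty k zxs).
  + exact: (iterates_bounded F_monotone g_proper g_convex g_lsc alpha_ge1 alpha_le2 cE L0_gt0
    g0 rho_init gammaE rhoE xE zer_nonempty gxs).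
- split; first exact: (hull_exists F_monotone F_lipschitz g_proper g_convex g_lsc alpha_ge1 alpha_le2 cE L0_gt0
    g0 rho_init gammaE rhoE xE zer_nonempty).
  move=> A L AL; exact: (stepsize_magnitude alpha_ge1 alpha_le2 cE L0_gt0 g0 rho_init gammaE rhoE AL).
- split; first exact: (gap_min_le F_monotone g_proper g_convex g_lsc alpha_ge1 alpha_le2 cE L0_gt0
    g0 rho_init gammaE rhoE xE zer_nonempty gxs).
  exact: (gap_min_rate F_monotone F_lipschitz g_proper g_convex g_lsc alpha_ge1 alpha_le2 cE L0_gt0
    g0 rho_init gammaE rhoE xE zer_nonempty gxs).
- move=> A L AL init K; exact: (stepsize_average_magnitude alpha_ge1 alpha_le2 cE L0_gt0 g0 rho_init gammaE rhoE AL init).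
- split; first exact: (iterates_converge F_monotone F_lipschitz g_proper g_convex g_lsc alpha_ge1 alpha_le2 cE L0_gt0
    g0 rho_init gammaE rhoE xE zer_nonempty).
  move=> z /zer_subdifferential gz; exact: (gap_cvg0 F_monotone F_lipschitz g_proper g_convex g_lsc alpha_ge1 alpha_le2 cE L0_gt0
    g0 rho_init gammaE rhoE xE zer_nonempty gz).
Qed.
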